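(* Let $k,r,m$ be integers with $k,r\ge 1$ and $1\le m<2^k\cdot 3^r$, let $a,b\in\mathbb{Z}$ be such that $F(x)=x^{2^k\cdot 3^r}+ax^m+b$ is irreducible over $\mathbb{Q}$, and let $K=\mathbb{Q}(\theta)$ where $\theta\in\mathbb{C}$ is a root of $F(x)$. Suppose that one of the following conditions holds: (1) $k\ge 1$, $r\ge 2$, $a\equiv 9,18\pmod{27}$ and $b\equiv -1\pmod{27}$; (2) $k\ge 1$, $r\ge 3$, $a\equiv 27,54\pmod{81}$ and $b\equiv -1\pmod{81}$; (3) $k\ge 1$, $r\ge 2$, $a\equiv 0\pmod{27}$ and $b\equiv 8,17\pmod{27}$; (4) $k\ge 1$, $r\ge 3$, $a\equiv 0\pmod{81}$ and $b\equiv 26,53\pmod{81}$; (5) $k\ge 1$, $r=1$, $a\equiv 0\pmod 9$ and $b\equiv -1\pmod 9$; (6) $k\ge 1$, $r=2$, $a\equiv 0\pmod{27}$ and $b\equiv -1\pmod{27}$; (7) $k=1$, $r\ge 7$, $a\equiv 3^7,\,2\cdot 3^7\pmod{3^8}$ and $b\equiv 1\pmod{3^8}$; (8) $k=1$, $r\ge 7$, $a\equiv 0\pmod{3^8}$ and $b\equiv 1+3^7,\,1+2\cdot 3^7\pmod{3^8}$; (9) $k=1$, $r=6$, $a\equiv 0\pmod{3^7}$ and $b\equiv 1\pmod{3^7}$; (10) $k=2$, $r\ge 4$, $a\equiv 81,162\pmod{243}$ and $b\equiv 1\pmod{243}$; (11) $k=2$, $r\ge 4$, $a\equiv 0\pmod{243}$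 and $b\equiv 82,163\pmod{3^5}$; (12) $k=2$, $r=3$, $a\equiv 0\pmod{81}$ and $b\equiv 1\pmod{81}$. Then $K$ is not monogenic.
   Context: A number field $K$ with ring of integers $\mathbb{Z}_K$ is called monogenic if there is $\eta\in\mathbb{Z}_K$ with $\mathbb{Z}_K=\mathbb{Z}[\eta]$. A congruence such as $a\equiv 9,18\pmod{27}$ means that $a$ is congruent to one of the listed residues. *)

(* Defs.v *)
From HB Require Import structures.
From mathcomp Require Import all_boot all_order all_algebra all_field.
Set Implicit Arguments.
Unset Strict Implicit.
Unset Printing Implicit Defensive.
Import Order.TTheory GRing.Theory Num.Theory.
Local Open Scope ring_scope.

(* A number field is a [fieldExtType rat], i.e. a finite extension of Q. *)

Definition in_ring_of_integers (K : fieldExtType rat) (x : K) : Prop :=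
  integralOver (intr : int -> K) x.

Definition in_Z_adjoin (K : fieldExtType rat) (eta x : K) : Prop :=
  exists p : {poly int}, x = (map_poly (intr : int -> K) p).[eta].

Definition monogenic (K : fieldExtType rat) : Prop :=
  exists eta : K, in_ring_of_integers eta /\
    forall x : K, in_ring_of_integers x <-> in_Z_adjoin eta x.

Definition trinomial (n m : nat) (a b : int) : {poly int} :=
  'X^n + a *: 'X^m + b%:P.

Definition irreducible_over_Q (p : {poly int}) : Prop :=
  irreducible_poly (map_poly (intr : int -> rat) p).

(* Main.v *)
Require Import Defs.
From HB Require Import structures.
From mathcomp Require Import all_boot all_order all_algebra all_field.
From mathcomp Require Import ring zify.
Set Implicit Arguments.
Unset Strict Implicit.
Unset Printing Implicit Defensive.
Import Order.TTheory GRing.Theory Num.Theory.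
Local Open Scope ring_scope.

(** Suppose Z_K = Z[eta], let g be the minimal polynomial of eta and write
theta = T(eta). The primes above 3 are then the roots of g in an algebraic
closure of F_3, taken up to Frobenius, and their ramification indices are the
multiplicities e of these roots. Put pi = theta^(2^k) - s with s = 1 or -1
according to the case, so that F = x^n - s = (x^(2^k) - s)^(3^r) mod 3, and
let v be 2, 3, 4 or 7 according to the case: 3^v divides a and b + s.

The pi-adic Newton polygon of F has v sides. Dividing the successive Horner
quotients of F by powers of 3 yields integral elements eps_i, and as they are
polynomials in eta, each root x of g is attached to one of the sides: its
multiplicity is 3^(r-v+1) * c * m(x), where c is one of the "coins"
1, 2, 2*3, 2*3^2, ..., 2*3^(v-2) and m(x) is the smaller of e and the
multiplicity of x as a root of the reduction of pi. The multiplicities of the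
roots x with T(x) = z, for a given root z of x^(2^k) - s, add up to 3^r,
which takes at least v coins, and exactly v only if each coin is used once.
On the other hand the sum of all the m(x) is the corank of pi mod 3, hence at
most the 3-adic valuation of the norm of any lift of pi mod 3, and a
resultant computation exhibits a lift of norm valuation 2^k * v.

So above each z there are exactly v roots, with distinct multiplicities; they
are fixed by any power of the Frobenius that fixes z. This produces at least
four elements of F_3, or at least fourteen elements of F_9. *)

(** * Reduction of integers and integer polynomials modulo a prime *)

Lemma intr_eq0_pchar (R : nzRingType) (p : nat) (z : int) :
  p \in [pchar R] -> (z%:~R == 0 :> R) = (p%:Z %| z)%Z.
Proof.
move=> pcharR; case: (intP z) => [|k|k]; rewrite ?mulr0z ?dvdz0 ?eqxx //.
  by rewrite -pmulrn -(dvdn_pcharf pcharR).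
by rewrite mulrNz oppr_eq0 -pmulrn -(dvdn_pcharf pcharR) dvdzE abszN.
Qed.

Lemma map_poly_intr_rmorph (R S : nzRingType) (f : {rmorphism R -> S})
    (A : {poly int}) :
  map_poly f (map_poly intr A) = map_poly intr A.
Proof.
by rewrite -map_poly_comp; apply: eq_map_poly => z; apply: rmorph_int.
Qed.

Lemma poly_int_dvd (d : int) (A : {poly int}) :
  (forall j, (d %| A`_j)%Z) -> exists B : {poly int}, A = d *: B.
Proof.
move=> dA; exists (map_poly (fun z => (z %/ d)%Z) A).
by apply/polyP => i; rewrite coefZ coef_map_id0 ?div0z // mulrC divzK.
Qed.

Lemma mup_exp (L : fieldType) (x : L) (A : {poly L}) (k : nat) :
  A != 0 -> mup x (A ^+ k) = (k * mup x A)%N.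
Proof.
move=> A_neq0; elim: k => [|k IHk]; first by rewrite expr0 mupNroot ?root1.
by rewrite exprS mupM ?expf_neq0 // IHk mulSn.
Qed.

(** * Determinants of polynomials in a matrix, resultants and coranks *)

Lemma horner_char_poly (R : comNzRingType) (n : nat) (A : 'M[R]_n) (x : R) :
  (char_poly A).[x] = \det (x%:M - A).
Proof.
rewrite -horner_evalE -det_map_mx; congr (\det _).
apply/matrixP => i j; rewrite !mxE /= /horner_eval !hornerE.
by rewrite hornerMn hornerX.
Qed.

(** Both sides are multiplicative in [T], which splits over [L]. This leaves constants and factors
    ['X - t%:P], for which the determinant is the value of [char_poly C] at [t] up to the sign
    [(-1) ^+ n.+1]. *)
Lemma det_horner_mx (L : closedFieldType) (n : nat) (C : 'M[L]_n.+1)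
    (rs : seq L) (T : {poly L}) :
  char_poly C = \prod_(x <- rs) ('X - x%:P) ->
  \det (horner_mx C T) = \prod_(x <- rs) T.[x].
Proof.
move=> charC.
have size_rs : size rs = n.+1.
  by apply/eqP; rewrite -eqSS -(size_prod_XsubC rs id) -charC size_char_poly.
have detXsubC (t : L) :
    \det (horner_mx C ('X - t%:P)) = \prod_(x <- rs) ('X - t%:P).[x].
  rewrite rmorphB /= horner_mx_X horner_mx_C -opprB -scaleN1r detZ.
  rewrite -horner_char_poly charC horner_prod -size_rs.
  elim: (rs) => [|x s IHs]; first by rewrite !big_nil mulr1.
  by rewrite !big_cons exprS -mulrA [_ ^+ _ * _]mulrCA IHs mulrA !hornerE /= mulN1r opprB.
have [ts ->] := closed_field_poly_normal T.
rewrite linearZ /= detZ rmorph_prod /=.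
under [RHS]eq_bigr => x _ do rewrite hornerZ horner_prod.
rewrite big_split /= big_const_seq iter_mulr_1 count_predT size_rs exchange_big /=.
congr (_ * _).
elim: ts => [|t ts IHts]; first by rewrite !big_nil det1.
by rewrite !big_cons det_mulmx IHts detXsubC.
Qed.

(** Over an infinite field it suffices to compare values: at [y] the left side is the determinant of
    the polynomial [y - T] taken at [C]. *)
Lemma char_poly_horner_mx (L : closedFieldType) (n : nat) (C : 'M[L]_n.+1)
    (rs : seq L) (T : {poly L}) :
  char_poly C = \prod_(x <- rs) ('X - x%:P) ->
  char_poly (horner_mx C T) = \prod_(x <- rs) ('X - T.[x]%:P).
Proof.
move=> charC; apply/eqP; rewrite -subr_eq0; apply: contraT => /closed_nonrootP[y].
case/negP; rewrite /root hornerD hornerN horner_char_poly subr_eq0.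
rewrite -[y%:M](horner_mx_C C) -rmorphB /= (det_horner_mx _ charC) horner_prod.
by apply/eqP/eq_bigr => x _; rewrite !hornerE.
Qed.

(** Symmetry of the resultant: over [algC] both determinants are products of all differences between
    an eigenvalue of [A] and one of [B]. *)
Lemma det_char_poly_sym (n m : nat) (A : 'M[int]_n.+1) (B : 'M[int]_m.+1) :
  exists e : bool,
    \det (horner_mx A (char_poly B)) = (-1) ^+ e * \det (horner_mx B (char_poly A)).
Proof.
pose toC : {rmorphism int -> algC} := intr.
have toC_inj : injective toC by exact: intr_inj.
pose AC := map_mx toC A; pose BC := map_mx toC B.
have splits p (M : 'M[algC]_p) :
    {rs : seq algC | char_poly M = \prod_(x <- rs) ('X - x%:P)}.
  have [rs] := closed_field_poly_normal (char_poly M).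
  by rewrite (monicP (char_poly_monic M)) scale1r => ?; exists rs.
have [[rs charA] [ts charB]] := (splits _ AC, splits _ BC).
exists (odd (size rs * size ts)); rewrite signr_odd.
apply: toC_inj; rewrite rmorphM rmorphXn rmorphN1.
rewrite -[toC (\det (horner_mx A _))]det_map_mx -[toC (\det (horner_mx B _))]det_map_mx.
rewrite !map_horner_mx !map_char_poly -/AC -/BC.
rewrite (det_horner_mx _ charA) (det_horner_mx _ charB) charA charB.
under eq_bigr => x _ do rewrite horner_prod.
under [in RHS]eq_bigr => x _ do rewrite horner_prod.
rewrite [in RHS]exchange_big /=; elim: rs {charA} => [|x rs IHrs].
  by rewrite !big_nil mul1r.
rewrite !big_cons mulSn exprD IHrs mulrACA; congr (_ * _).
elim: ts {charB IHrs} => [|t ts IHts]; first by rewrite !big_nil mul1r.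
by rewrite !big_cons exprS mulrACA IHts !hornerE /= mulN1r opprB.
Qed.

(* Row operations mod [p] clear [n - rank] rows; lifting them to the integers
   keeps the determinant prime to [p]. *)
Lemma dvdz_det_corank (p n : nat) (M : 'M[int]_n) : prime p ->
  (p%:Z ^+ (n - \rank (map_mx (intr : int -> 'F_p) M)) %| \det M)%Z.
Proof.
move=> p_pr; pose red : {rmorphism int -> 'F_p} := intr.
pose Mp := map_mx red M; rewrite -/red -/Mp.
have red0 (z : int) : (red z == 0) = (p%:Z %| z)%Z.
  by rewrite (@intr_eq0_pchar _ p) ?pchar_Fp.
pose lift (z : 'F_p) : int := (z : nat)%:Z.
have liftK : cancel lift red by move=> z; exact: natr_Zp.
pose L := map_mx lift (invmx (col_ebase Mp)).
have LK : map_mx red L = invmx (col_ebase Mp).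
  by apply/matrixP => i j; rewrite !mxE liftK.
have detL : coprimez (p%:Z ^+ (n - \rank Mp)) (\det L).
  rewrite coprimezE abszX; apply: coprimeXl; rewrite prime_coprime //.
  rewrite -[(_ %| _)%N]/(_ %| _)%Z -red0 -det_map_mx LK.
  by rewrite -unitfE -unitmxE unitmx_inv col_ebase_unit.
rewrite -(Gauss_dvdzr _ detL) -det_mulmx.
have redLM : map_mx red (L *m M) = pid_mx (\rank Mp) *m row_ebase Mp.
  rewrite map_mxM LK -/Mp; apply: (canLR (mulKmx (col_ebase_unit Mp))).
  by rewrite mulmxA mulmx_ebase.
have Lrow (i : 'I_n) j : (\rank Mp <= i)%N -> (p%:Z %| (L *m M) i j)%Z.
  move=> ri; rewrite -red0; move/matrixP/(_ i j): redLM; rewrite mxE => ->.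
  rewrite mxE big1 // => k _; rewrite mxE ltnNge ri andbF.
  by rewrite mul0r.
set X := L *m M in Lrow *.
rewrite /determinant; apply: (big_ind (fun x => _ %| x)%Z) => [|x y|s _];
  rewrite ?dvdz0 //.
  exact: rpredD.
apply: dvdz_mull.
rewrite (bigID (fun i : 'I_n => (\rank Mp <= i)%N)) /=; apply: dvdz_mulr.
rewrite (_ : (n - _)%N = #|[pred i : 'I_n | (\rank Mp <= i)%N]|).
  rewrite -prodr_const; apply: (big_ind2 (fun x y => (x %| y)%Z)) => //.
    by move=> *; apply: dvdz_mul.
  by move=> i /Lrow.
rewrite -sum1_card -(big_mkord (fun i => (\rank Mp <= i)%N) (fun=> 1%N)).
rewrite -[LHS]muln1 -sum_nat_const_nat (big_nat_widenl _ 0) //.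
Qed.

(** * Cyclic matrices *)

(* The first basis vector is then cyclic for [C]. *)
Definition shifts (R : pzSemiRingType) (n : nat) (C : 'M[R]_n) : Prop :=
  forall i j : 'I_n, j = i.+1 :> nat ->
    delta_mx 0 i *m C = delta_mx 0 j :> 'rV_n.

Lemma companion_exists (R : comNzRingType) (n : nat) (g : {poly R}) :
  g \is monic -> size g = n.+1 ->
  exists2 C : 'M[R]_n, char_poly C = g & shifts C.
Proof.
move=> g_monic size_g; have n_eq : (size g).-1 = n by rewrite size_g.
move: (companionmx g) (companionmxK g_monic) (@mulmx_delta_companion _ g).
rewrite n_eq => C charC shiftC; exists C => // i j jE.
have lt_i : (i.+1 < n)%N by rewrite -jE.
by rewrite (shiftC i lt_i); congr delta_mx; apply: val_inj.
Qed.

Lemma map_shifts (R S : pzSemiRingType) (f : {rmorphism R -> S}) (n : nat)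
  (C : 'M[R]_n) : shifts C -> shifts (map_mx f C).
Proof. by move=> shC i j /shC; rewrite -!(map_delta_mx f) -map_mxM => ->. Qed.

(** Row vectors thus stand for polynomials modulo [char_poly C], with [C] acting as multiplication
    by ['X]. *)
Lemma shifts_horner_mx (R : comNzRingType) (n : nat) (C : 'M[R]_n.+1)
    (A : {poly R}) :
  shifts C -> (size A <= n.+1)%N -> delta_mx 0 0 *m horner_mx C A = poly_rV A.
Proof.
move=> shC sizeA.
have shiftX i (lt_i : (i < n.+1)%N) :
    delta_mx 0 0 *m horner_mx C 'X^i = delta_mx 0 (Ordinal lt_i) :> 'rV_n.+1.
  elim: i lt_i => [|i IHi] lt_i.
    by rewrite expr0 rmorph1 mulmx1; congr delta_mx; apply: val_inj.
  rewrite exprSr rmorphM /= horner_mx_X mulmxA.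
  by rewrite (IHi (ltnW lt_i)); apply: shC.
rewrite -[in LHS](poly_rV_K sizeA) [rVpoly _]poly_def rmorph_sum mulmx_sumr.
rewrite [RHS]row_sum_delta; apply: eq_bigr => i _.
rewrite /= horner_mxZ -scalemxAr valK shiftX; congr (_ *: delta_mx _ _).
exact: val_inj.
Qed.

(** Write [char_poly C = c * d]. The multiples of [c] of degree at most [n] form a space of
    dimension the degree of [d], and [P] taken at [C] kills it because [char_poly C] divides
    [c * P]. *)
Lemma rank_horner_mx_le (L : fieldType) (n : nat) (C : 'M[L]_n.+1)
    (d P : {poly L}) :
  shifts C -> d %| char_poly C -> d %| P ->
  (\rank (horner_mx C P) + (size d).-1 <= n.+1)%N.
Proof.
set g := char_poly C => shC /dvdpP[c gE] /dvdpP[P1 PE].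
have size_g : size g = n.+2 by rewrite size_char_poly.
have g_neq0 : g != 0 by rewrite -size_poly_eq0 size_g.
have [c_neq0 d_neq0] : c != 0 /\ d != 0.
  by apply/andP; rewrite -negb_or -mulf_eq0 -gE.
have [c_gt0 d_gt0] : (0 < size c)%N /\ (0 < size d)%N.
  by rewrite !size_poly_gt0.
have sizecd : ((size c).-1 + (size d).-1 = n.+1)%N.
  have arith x y : (0 < x -> 0 < y -> (x + y).-1 = n.+2 -> x.-1 + y.-1 = n.+1)%N.
    by lia.
  by apply: arith => //; rewrite -size_mul // -gE.
pose K : 'M[L]_((size d).-1, n.+1) := lin1_mx (poly_rV \o c \*o rVpoly).
have mulK v : v *m K = poly_rV (c * rVpoly v) by rewrite mul_rV_lin1.
have size_cv (v : 'rV_(size d).-1) : (size (c * rVpoly v)%R <= n.+1)%N.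
  apply: leq_trans (size_polyMleq _ _) _.
  have arith x y z : (0 < x -> x.-1 + y = n.+1 -> z <= y -> (x + z).-1 <= n.+1)%N.
    by lia.
  exact: arith c_gt0 sizecd (size_poly _ _).
have freeK : row_free K.
  rewrite -kermx_eq0; apply/rowV0P => v /sub_kermxP.
  rewrite mulK => /(congr1 rVpoly); rewrite poly_rV_K // linear0 => /eqP.
  rewrite mulf_eq0 (negPf c_neq0) => /eqP v0.
  by rewrite -(rVpolyK v) v0 linear0.
have KP : K *m horner_mx C P = 0.
  apply/row_matrixP => i; rewrite row_mul row0 rowE mulK.
  rewrite -(shifts_horner_mx shC (size_cv _)) -mulmxA.
  set w := rVpoly _; suff -> : horner_mx C (c * w) *m horner_mx C P = 0.
    by rewrite mulmx0.
  rewrite -[LHS]/(_ * _) -rmorphM /= PE.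
  have -> : c * w * (P1 * d) = g * (P1 * w) by rewrite gE; ring.
  by rewrite rmorphM /= Cayley_Hamilton mul0r.
by rewrite addnC -(eqP freeK); apply: mulmx0_rank_max.
Qed.

(** * A coin-changing problem *)

(* Horizontal lengths of the sides of the Newton polygon, from left to right,
   divided by the first one. *)
Definition coin (i : nat) : nat := if i is j.+1 then (2 * 3 ^ j)%N else 1%N.

(** Induction on [w]. From the third on, coins are multiples of 6, so the first two kinds together
    pay a multiple [3 * x] of 3; paying [x] by unit coins and dividing the rest by 3 gives the
    problem for the previous [w]. The total is odd, hence so is [d 0], and the trade saves
    [(2 * d 0 + d 1) / 3 > 0] coins. A saving of exactly 1 with [x = 1] forces [d 0 = d 1 = 1]. *)
Lemma coin_change (w : nat) (d : nat -> nat) :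
  (\sum_(i < w.+1) coin i * d i = 3 ^ w)%N ->
  (w < \sum_(i < w.+1) d i)%N /\
  ((\sum_(i < w.+1) d i)%N = w.+1 -> forall i, (i < w.+1)%N -> d i = 1%N).
Proof.
elim: w d => [|w IHw] d.
  rewrite !big_ord1 mul1n expn0 /= => d0; rewrite d0.
  by split=> // _ [|i].
rewrite !big_ord_recl /= mul1n /bump /= add1n.
set S := (\sum_(i < w) _)%N; set S' := (\sum_(i < w) _)%N; rewrite expnS => total.
have SE : (S = 3 * \sum_(i < w) coin i.+1 * d i.+2)%N.
  rewrite big_distrr; apply: eq_bigr => i _ /=.
  by rewrite expnS; ring.
set S1 := (\sum_(i < w) coin i.+1 * d i.+2)%N in SE.
have even_S1 : exists S2, S1 = (2 * S2)%N.
  exists (\sum_(i < w) 3 ^ i * d i.+2)%N; rewrite big_distrr.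
  by apply: eq_bigr => i _ /=; ring.
have odd3w : odd (3 ^ w) by rewrite oddX orbT.
pose x := ((d 0 + 2 * d 1) %/ 3)%N.
have xE : (d 0 + 2 * d 1 = 3 * x)%N by lia.
pose d' i := if i is j.+1 then d j.+2 else x.
have /IHw[] : (\sum_(i < w.+1) coin i * d' i = 3 ^ w)%N.
  by rewrite big_ord_recl /= -/S1; lia.
rewrite big_ord_recl /= -/S'.
have [S2 S1E] := even_S1.
have odd_d0 : (0 < d 0)%N.
  by lia.
move=> lex eqx; split; first by lia.
move=> eqS; have x1 : (x + S' = w.+1)%N by lia.
have d_eq := eqx x1; have := d_eq 0 isT => /= x_eq1.
case=> [|[|i]] lti; [lia|lia|exact: (d_eq i.+1)].
Qed.

(** Group the points by coin and let [d i] be the total of [m] over the group of coin [i]. In the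
    extremal case every group has total 1, so it is a single point with [m x = 1], and [e x]
    determines the coin, hence the point. *)
Lemma coin_change_points (T : eqType) (A : seq T) (e m : T -> nat) (t w : nat) :
  uniq A -> {in A, forall x, 0 < m x}%N ->
  {in A, forall x, exists2 i, (i <= w)%N & e x = (3 ^ t * coin i * m x)%N} ->
  (\sum_(x <- A) e x = 3 ^ (t + w))%N ->
  (w < \sum_(x <- A) m x)%N /\
  ((\sum_(x <- A) m x)%N = w.+1 -> size A = w.+1 /\ {in A &, injective e}).
Proof.
move=> uniqA m_gt0 eE sum_e.
(* Taking the first index that fits makes the coin a function of [e x] and [m x], so points that
   agree in both fall into the same group. *)
pose type y z := find (fun i => y == (3 ^ t * coin i * z)%N) (iota 0 w.+1).
pose ty x := type (e x) (m x).
have tyP x : x \in A -> (ty x < w.+1)%N /\ e x = (3 ^ t * coin (ty x) * m x)%N.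
  move=> /eE[i lei ex].
  have has_i : has (fun i => e x == (3 ^ t * coin i * m x)%N) (iota 0 w.+1).
    by apply/hasP; exists i; rewrite ?mem_iota ?ex //= add0n ltnS.
  have lt_ty : (ty x < w.+1)%N by rewrite -[w.+1](size_iota 0) -has_find.
  by split=> //; have /eqP := nth_find 0%N has_i; rewrite nth_iota.
pose d i := (\sum_(x <- A | ty x == i) m x)%N.
have split_sum (f : T -> nat) :
    (\sum_(x <- A) f x = \sum_(i < w.+1) \sum_(x <- A | ty x == i) f x)%N.
  rewrite (exchange_big_dep predT) //= !big_seq; apply: eq_bigr => x xA.
  have [lt_ty _] := tyP x xA.
  by rewrite (big_pred1 (Ordinal lt_ty)).
have sum_d : (\sum_(x <- A) m x = \sum_(i < w.+1) d i)%N by exact: split_sum.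
have /coin_change[le_d eq_d] : (\sum_(i < w.+1) coin i * d i = 3 ^ w)%N.
  apply/eqP; rewrite -(eqn_pmul2l (expn_gt0 3 t)) -expnD -sum_e split_sum.
  rewrite big_distrr; apply/eqP/eq_bigr => i _ /=.
  rewrite !big_distrr /= big_seq_cond [RHS]big_seq_cond.
  apply: eq_bigr => x /andP[xA /eqP tyx]; have [_ ->] := tyP x xA.
  by rewrite tyx; ring.
rewrite sum_d; split=> // {}/eq_d d1.
have m1 x : x \in A -> m x = 1%N.
  move=> xA; have [lt_ty _] := tyP x xA; apply/eqP.
  rewrite eqn_leq m_gt0 // andbT -(d1 _ lt_ty) /d.
  by rewrite -big_filter (bigD1_seq x) ?filter_uniq ?leq_addr // mem_filter eqxx.
split.
  have <- : (\sum_(i < w.+1) d i = w.+1)%N.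
    by rewrite (eq_bigr (fun=> 1%N)) ?sum1_card ?card_ord // => i _; apply: d1.
  rewrite -sum_d big_seq (eq_bigr (fun=> 1%N)) => [|x /m1 //].
  by rewrite -big_seq sum1_size.
move=> x y xA yA exy; apply: contraTeq isT => neq_xy.
have tyxy : ty x = ty y by rewrite /ty !m1 // exy.
have [lt_ty _] := tyP x xA.
have := d1 _ lt_ty; rewrite /d -big_filter.
rewrite (bigD1_seq x) ?filter_uniq ?mem_filter ?eqxx //=.
rewrite -big_filter (bigD1_seq y) ?filter_uniq //=.
  by rewrite !m1 // !add1n.
by rewrite !mem_filter eq_sym neq_xy tyxy eqxx yA.
Qed.

(** * Multiplicities of roots in characteristic p *)

Lemma pchar_closure (p : nat) (L : fieldType) (phi : {rmorphism 'F_p -> L}) :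
  prime p -> p \in [pchar L].
Proof.
by move=> p_pr; rewrite (fmorph_pchar phi) pchar_Fp.
Qed.

Lemma map_poly_intr_eq0 (p : nat) (A : {poly int}) : prime p ->
  map_poly (intr : int -> 'F_p) A = 0 -> exists B : {poly int}, A = p%:Z *: B.
Proof.
move=> p_pr A0; apply: poly_int_dvd => i.
rewrite -(@intr_eq0_pchar 'F_p) ?pchar_Fp //.
by move/polyP/(_ i): A0; rewrite coef_map coef0 => ->.
Qed.

Lemma map_poly_intr_surj (p : nat) (B : {poly 'F_p}) : prime p ->
  exists A : {poly int}, map_poly (intr : int -> 'F_p) A = B.
Proof.
move=> p_pr; exists (map_poly (fun z : 'F_p => (z : nat)%:Z) B).
by apply/polyP => i; rewrite coef_map coef_map_id0 //=; apply: natr_Zp.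
Qed.

Lemma map_poly_intr_dvd (p : nat) (h A : {poly int}) : prime p ->
  map_poly (intr : int -> 'F_p) h %| map_poly (intr : int -> 'F_p) A ->
  exists B C : {poly int}, A = h * B + p%:Z *: C.
Proof.
move=> p_pr /dvdpP[b AE]; have [B BE] := map_poly_intr_surj b p_pr.
have [|C CE] := @map_poly_intr_eq0 p (A - h * B) p_pr.
  by rewrite rmorphB rmorphM /= AE BE mulrC subrr.
by exists B, C; rewrite -CE; ring.
Qed.

(* If [Q] vanished at [x] too, then, for a lift [h] of the gcd of the three
   reductions, [p *: W] would lie in the square of the ideal (p, h), forcing
   [W] into (p, h). *)
Lemma cofactor_not_root (p : nat) (L : fieldType) (phi : {rmorphism 'F_p -> L})
    (g P E W Q : {poly int}) (N : nat) (x : L) :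
  prime p -> g \is monic -> (1 < N)%N -> E * P ^+ N = p%:Z *: W + g * Q ->
  root (map_poly intr g) x -> root (map_poly intr P) x ->
  ~~ root (map_poly intr W) x -> ~~ root (map_poly intr Q) x.
Proof.
move=> p_pr g_monic N_gt1 relE gx Px; apply: contra => Qx.
pose red : {rmorphism int -> 'F_p} := intr.
have phiE (A : {poly int}) : map_poly phi (map_poly red A) = map_poly intr A.
  exact: map_poly_intr_rmorph.
pose hp := gcdp (gcdp (map_poly red P) (map_poly red g)) (map_poly red Q).
have [h hE] := map_poly_intr_surj hp p_pr.
have hx : root (map_poly intr h) x.
  by rewrite -phiE hE /hp !gcdp_map !root_gcd !phiE Px gx Qx.
have hp_neq0 : hp != 0.
  by rewrite gcdp_eq0 gcdp_eq0 negb_and negb_and (monic_neq0 (monic_map red g_monic)) orbT.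
have [P1 [P2 PE]] : exists B C : {poly int}, P = h * B + p%:Z *: C.
  apply: map_poly_intr_dvd; rewrite // hE.
  by apply: dvdp_trans (dvdp_gcdl _ _) _; apply: dvdp_gcdl.
have [g1 [g2 gE]] : exists B C : {poly int}, g = h * B + p%:Z *: C.
  apply: map_poly_intr_dvd; rewrite // hE.
  by apply: dvdp_trans (dvdp_gcdl _ _) _; apply: dvdp_gcdr.
have [Q1 [Q2 QE]] : exists B C : {poly int}, Q = h * B + p%:Z *: C.
  by apply: map_poly_intr_dvd; rewrite // hE dvdp_gcdr.
have [N' NE] : exists N', N = (N' + 2)%N by exists (N - 2)%N; rewrite subnK.
rewrite NE exprD in relE; set EP := E * P ^+ N'.
pose Wh := EP * P1 ^+ 2 - g1 * Q1.
pose Wp := EP * (P2 * P1 *+ 2) - (g1 * Q2 + g2 * Q1).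
pose Wpp := EP * P2 ^+ 2 - g2 * Q2.
have WE : p%:Z *: W = h ^+ 2 * Wh + p%:Z *: (h * Wp + p%:Z *: Wpp).
  apply: (addIr (g * Q)); rewrite -relE /Wh /Wp /Wpp mulrA -/EP.
  rewrite {1}PE gE QE -!mul_polyC.
  by ring.
have [|Wh' WhE] := @map_poly_intr_eq0 p Wh p_pr.
  apply/eqP; have := congr1 (map_poly red) WE.
  have p0 : red p%:Z = 0 by apply/eqP; rewrite (@intr_eq0_pchar _ p) ?pchar_Fp.
  rewrite rmorphD rmorphM rmorphXn /= !map_polyZ p0 !scale0r addr0 hE => /esym/eqP.
  by rewrite mulf_eq0 expf_eq0 (negPf hp_neq0) andbF.
have p_neq0 : p%:Z != 0 by rewrite -lt0n prime_gt0.
have {}WE : W = h ^+ 2 * Wh' + (h * Wp + p%:Z *: Wpp).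
  apply: (@mulfI _ p%:Z%:P); rewrite ?polyC_eq0 // mul_polyC WE WhE.
  by rewrite -!mul_polyC; ring.
have pL0 : p%:Z%:~R = 0 :> L.
  by apply/eqP; rewrite (@intr_eq0_pchar _ p) ?(pchar_closure phi).
rewrite /root WE !(rmorphD, rmorphM) /= map_polyZ /= pL0 scale0r.
by rewrite !hornerE (eqP hx) !mul0r /= !addr0 eqxx.
Qed.

(** Modulo [p] the relation reads [E * P ^+ N = g * Q]; compare multiplicities at [x]. If [N > 1],
    then [Q] does not vanish at [x], so [mu g = N * mu P] and the minimum is [mu P]. If [N = 1],
    then [mu P = mu g + mu Q] and the minimum is [mu g]. *)
Lemma mup_minn_eq (p : nat) (L : fieldType) (phi : {rmorphism 'F_p -> L})
    (g P E W Q : {poly int}) (N : nat) (x : L)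
    (mu := fun A : {poly int} => mup x (map_poly intr A)) :
  prime p -> g \is monic -> (0 < N)%N -> E * P ^+ N = p%:Z *: W + g * Q ->
  root (map_poly intr g) x -> root (map_poly intr P) x ->
  ~~ root (map_poly intr E) x ->
  (1 < N)%N ==> ~~ root (map_poly intr W) x ->
  map_poly (intr : int -> L) P != 0 ->
  mu g = (N * minn (mu g) (mu P))%N.
Proof.
move=> p_pr g_monic N_gt0 relE gx Px Ex Wx P_neq0.
have pL0 : p%:Z%:~R = 0 :> L.
  by apply/eqP; rewrite (@intr_eq0_pchar _ p) ?(pchar_closure phi).
have := congr1 (map_poly (intr : int -> L)) relE.
rewrite rmorphD !rmorphM rmorphXn /= map_polyZ /= pL0 scale0r add0r => relL.
have E_neq0 : map_poly (intr : int -> L) E != 0.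
  by apply: contraNneq Ex => ->; rewrite root0.
have EP_neq0 : map_poly (intr : int -> L) E * map_poly intr P ^+ N != 0.
  by rewrite mulf_neq0 // expf_neq0.
have /andP[gL_neq0 Q_neq0] : (map_poly (intr : int -> L) g != 0)
    && (map_poly (intr : int -> L) Q != 0).
  by rewrite -negb_or -mulf_eq0 -relL.
have := congr1 (mup x) relL.
rewrite mupMr // mup_exp // mupM // /mu.
have [N_gt1 eq_mu|N_le1] := ltnP 1 N.
  rewrite N_gt1 /= in Wx.
  have Qx := cofactor_not_root phi p_pr g_monic N_gt1 relE gx Px Wx.
  rewrite (mupNroot Qx) addn0 in eq_mu; rewrite -eq_mu.
  by rewrite (minn_idPr _) // leq_pmull.
have -> : N = 1%N by apply/eqP; rewrite eqn_leq N_le1.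
by rewrite !mul1n => ->; rewrite (minn_idPl _) // leq_addr.
Qed.

(** * Fibres of [T] and the action of Frobenius *)

Lemma mup_pFrobenius (p : nat) (L : fieldType) (A : {poly int}) (x : L) :
  p \in [pchar L] -> map_poly (intr : int -> L) A != 0 ->
  mup (x ^+ p) (map_poly intr A) = mup x (map_poly intr A).
Proof.
move=> pcharL A_neq0; pose Fr := pFrobenius_aut pcharL.
have FrA := map_poly_intr_rmorph Fr A.
have dvdFr m : (('X - (x ^+ p)%:P) ^+ m %| map_poly intr A) =
               (('X - x%:P) ^+ m %| map_poly intr A).
  by rewrite -[RHS](dvdp_map Fr) [map_poly _ (_ ^+ _)]rmorphXn /= rmorphB /= map_polyX map_polyC FrA.
apply/eqP; rewrite eqn_leq mup_geq // -dvdFr -mup_geq // leqnn /=.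
by rewrite mup_geq // dvdFr -mup_geq.
Qed.

Lemma sum_mup_le (L : closedFieldType) (A : seq L) (D : {poly L}) :
  uniq A -> D != 0 -> (\sum_(x <- A) mup x D <= (size D).-1)%N.
Proof.
move=> uniqA D_neq0; have [ds DE] := closed_field_poly_normal D.
have lc_neq0 : lead_coef D != 0 by rewrite lead_coef_eq0.
rewrite {2}DE size_scale // (size_prod_XsubC ds id) /=.
have mupD x : mup x D = count_mem x ds.
  by rewrite {1}DE -mul_polyC mupMr ?rootC // mu_prod_XsubC.
rewrite (eq_bigr _ (fun x _ => mupD x)); elim: ds {DE mupD} => [|y ds IHds] /=.
  by rewrite big1.
rewrite big_split /= -[(size ds).+1]add1n leq_add //.
have [yA|yNA] := boolP (y \in A).
  rewrite (bigD1_seq y) //= eqxx big1 // => x neq_xy.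
  by rewrite eq_sym (negPf neq_xy).
rewrite big_seq big1 // => x xA.
by case: eqP => // yx; rewrite yx xA in yNA.
Qed.

Lemma sum_count_undup (T : eqType) (rs : seq T) (a : pred T) :
  (\sum_(x <- undup rs | a x) count_mem x rs = count a rs)%N.
Proof.
rewrite -[RHS]sum1_count -[RHS]big_undup_iterop_count; apply: eq_bigr => x _.
by rewrite Monoid.iteropE iter_addn_0 mul1n.
Qed.

(** The rank hypothesis bounds the corank of [P] modulo [p] by [size zs * c]. The total of [m] over
    all roots is at most this corank, while each fibre contributes at least [c]; so each contributes
    exactly [c]. *)
Lemma points_over (p : nat) (L : closedFieldType) (phi : {rmorphism 'F_p -> L})
    (n c e : nat) (C : 'M[int]_n.+1) (T h : {poly int}) (zs : seq L)
    (toL := map_poly (intr : int -> L)) (g := char_poly C) (P := h \Po T)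
    (m := fun x : L => minn (mup x (toL g)) (mup x (toL P)))
    (above := fun (z : L) (A : seq L) => uniq A /\
       forall x, x \in A = (root (toL g) x && ((toL T).[x] == z))) :
  prime p -> shifts C -> uniq zs -> toL h = \prod_(z <- zs) ('X - z%:P) ->
  toL (char_poly (horner_mx C T)) = toL h ^+ e -> (0 < e)%N ->
  (n < \rank (map_mx (intr : int -> 'F_p) (horner_mx C P)) + size zs * c)%N ->
  (forall z A, z \in zs -> above z A -> \sum_(x <- A) mup x (toL g) = e ->
     c <= \sum_(x <- A) m x)%N ->
  forall z, z \in zs -> exists2 A, above z A &
    (\sum_(x <- A) mup x (toL g) = e)%N /\ (\sum_(x <- A) m x = c)%N.
Proof.
move=> p_pr C_shifts uniq_zs hE charT e_gt0 rank_ge c_le.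
have [rs gE] : exists rs, toL g = \prod_(x <- rs) ('X - x%:P).
  have [rs] := closed_field_poly_normal (toL g).
  by rewrite (monicP (monic_map _ (char_poly_monic C))) scale1r; exists rs.
pose CL := map_mx (intr : int -> L) C.
have charCL : char_poly CL = \prod_(x <- rs) ('X - x%:P).
  by rewrite -gE /toL map_char_poly.
have rsE : \prod_(x <- rs) ('X - ((toL T).[x])%:P) = toL h ^+ e.
  rewrite -charT -(char_poly_horner_mx (toL T) charCL).
  by rewrite /toL -map_horner_mx map_char_poly.
have root_g x : root (toL g) x = (x \in undup rs).
  by rewrite gE root_prod_XsubC mem_undup.
have T_zs x : x \in undup rs -> (toL T).[x] \in zs.
  rewrite mem_undup => x_rs; rewrite -root_prod_XsubC -hE.
  have : root (toL h ^+ e) (toL T).[x].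
    rewrite -rsE -(big_map (fun x => (toL T).[x]) predT (fun y => 'X - y%:P)).
    by rewrite root_prod_XsubC map_f.
  by rewrite /root horner_exp expf_eq0 e_gt0.
pose A z := [seq x <- undup rs | (toL T).[x] == z].
have aboveA z : above z (A z).
  split=> [|x]; first by rewrite filter_uniq ?undup_uniq.
  by rewrite mem_filter root_g andbC.
have h_neq0 : toL h != 0 by rewrite hE monic_neq0 // monic_prod_XsubC.
have mup_g x : mup x (toL g) = count_mem x rs by rewrite gE mu_prod_XsubC.
have sumA z : z \in zs -> (\sum_(x <- A z) mup x (toL g) = e)%N.
  move=> z_zs; rewrite big_filter (eq_bigr _ (fun x _ => mup_g x)).
  rewrite sum_count_undup.
  have := congr1 (mup z) rsE.
  rewrite mup_exp // hE mu_prod_XsubC (count_uniq_mem _ uniq_zs) z_zs muln1 => <-.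
  rewrite -(big_map (fun x => (toL T).[x]) predT (fun y => 'X - y%:P)).
  by rewrite mu_prod_XsubC count_map.
have g_neq0 : toL g != 0 by rewrite gE monic_neq0 // monic_prod_XsubC.
have total : (\sum_(z <- zs) \sum_(x <- A z) m x <= size zs * c)%N.
  (* Each [m x] is at most the multiplicity of [x] in this gcd, whose degree is at most the
     corank. *)
  pose D := gcdp (toL g) (toL P).
  have D_neq0 : D != 0 by rewrite gcdp_eq0 (negPf g_neq0).
  have sum_m : (\sum_(z <- zs) \sum_(x <- A z) m x = \sum_(x <- undup rs) m x)%N.
    under eq_bigr => z _ do rewrite big_filter.
    rewrite (exchange_big_dep predT) //= [LHS]big_seq [RHS]big_seq.
    apply: eq_bigr => x /T_zs x_zs; rewrite -big_filter.
    rewrite (bigD1_seq (toL T).[x]) ?filter_uniq ?mem_filter ?eqxx //=.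
    rewrite -big_filter -filter_predI big_filter big1 ?addn0 //.
    by move=> z /= /andP[/negPf neq /eqP eqz]; rewrite eqz eqxx in neq.
  have m_le x : (m x <= mup x D)%N.
    rewrite mup_geq // dvdp_gcd -mup_geq // geq_minl /=.
    have [->|P_neq0] := eqVneq (toL P) 0; first by rewrite dvdp0.
    by rewrite -mup_geq // geq_minr.
  rewrite sum_m; apply: leq_trans (_ : (\sum_(x <- undup rs) mup x D <= _)%N).
    by apply: leq_sum => x _; apply: m_le.
  apply: leq_trans (sum_mup_le (undup_uniq rs) D_neq0) _.
  have := @rank_horner_mx_le L n CL D (toL P) (map_shifts _ C_shifts) _ (dvdp_gcdr _ _).
  rewrite charCL -gE dvdp_gcdl => /(_ isT).
  have -> : \rank (horner_mx CL (toL P)) =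
            \rank (map_mx (intr : int -> 'F_p) (horner_mx C P)).
    rewrite -(mxrank_map phi) -map_mx_comp /toL -map_horner_mx; congr (\rank _).
    by apply/matrixP => i j; rewrite !mxE /= rmorph_int.
  move=> rank_le; rewrite -(leq_add2l (\rank (map_mx (intr : int -> 'F_p) (horner_mx C P)))).
  exact: leq_trans rank_le rank_ge.
move=> z z_zs; exists (A z); first exact: aboveA.
split; first exact: sumA.
have lower y : y \in zs -> (c <= \sum_(x <- A y) m x)%N.
  by move=> y_zs; apply: c_le y_zs (aboveA y) (sumA y y_zs).
apply/eqP; rewrite eqn_leq lower // andbT.
move: total; rewrite (bigD1_seq z) //= -sum1_size big_distrl /=.
rewrite [in leqRHS](bigD1_seq z) //= mul1n; set U := (\sum_(y <- zs | _) _)%N.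
set V := (\sum_(y <- zs | _) _)%N => total.
have leVU : (V <= U)%N.
  rewrite /U /V big_seq_cond [leqRHS]big_seq_cond; apply: leq_sum => y /andP[y_zs _].
  by rewrite ?mul1n lower.
by rewrite -(leq_add2r U); apply: leq_trans total _; rewrite leq_add2l.
Qed.

Lemma pFrobenius_horner (p : nat) (L : fieldType) (A : {poly int}) (x : L) :
  p \in [pchar L] ->
  (map_poly (intr : int -> L) A).[x ^+ p] = (map_poly intr A).[x] ^+ p.
Proof.
move=> pcharL; pose Fr := pFrobenius_aut pcharL.
have FrA := map_poly_intr_rmorph Fr A.
by rewrite -[in LHS]FrA -[x ^+ p]/(Fr x) horner_map.
Qed.

Lemma iter_pFrobenius (p : nat) (L : fieldType) (g T : {poly int}) (x : L) (k : nat)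
    (toL := map_poly (intr : int -> L)) :
  p \in [pchar L] -> toL g != 0 ->
  [/\ root (toL g) (x ^+ (p ^ k)) = root (toL g) x,
      (toL T).[x ^+ (p ^ k)] = (toL T).[x] ^+ (p ^ k) &
      mup (x ^+ (p ^ k)) (toL g) = mup x (toL g)].
Proof.
move=> pcharL g_neq0; elim: k => [|k [IHr IHT IHm]]; first by rewrite expn0 !expr1.
rewrite expnSr !exprM (pFrobenius_horner _ _ pcharL) IHT.
rewrite (mup_pFrobenius _ pcharL g_neq0); split=> //.
rewrite -IHr /root (pFrobenius_horner _ _ pcharL) expf_eq0.
by rewrite prime_gt0 // (pcharf_prime pcharL).
Qed.

Lemma size_fixed_le (L : fieldType) (q : nat) (X : seq L) :
  (1 < q)%N -> uniq X -> {in X, forall x, x ^+ q = x} -> (size X <= q)%N.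
Proof.
move=> q_gt1 uniqX fixX; pose Q : {poly L} := 'X^q - 'X.
have sizeQ : size Q = q.+1.
  by rewrite size_polyDl size_polyXn // size_polyN size_polyX.
rewrite -ltnS -sizeQ; apply: max_poly_roots => //.
  by rewrite -size_poly_eq0 sizeQ.
by apply/allP => x xX; rewrite /root !hornerE fixX ?subrr.
Qed.

(** The fibres are extremal for the coin problem, so each has [w.+1] points with distinct
    multiplicities. Over a [z] in [zs'], the [f]-th power of Frobenius maps the fibre to itself and
    preserves multiplicities, hence fixes every point; all these points are roots of
    ['X^(3 ^ f) - 'X]. *)
Lemma fixed_fibres_bound (L : closedFieldType) (phi : {rmorphism 'F_3 -> L})
    (n t w f : nat) (C : 'M[int]_n.+1) (T h : {poly int}) (zs zs' : seq L)
    (toL := map_poly (intr : int -> L)) (g := char_poly C) (P := h \Po T)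
    (m := fun x : L => minn (mup x (toL g)) (mup x (toL P))) :
  shifts C -> uniq zs -> toL h = \prod_(z <- zs) ('X - z%:P) ->
  toL (char_poly (horner_mx C T)) = toL h ^+ (3 ^ (t + w)) ->
  (n < \rank (map_mx (intr : int -> 'F_3) (horner_mx C P)) + size zs * w.+1)%N ->
  (forall x, root (toL g) x -> (toL T).[x] \in zs ->
    exists2 i, (i <= w)%N & mup x (toL g) = (3 ^ t * coin i * m x)%N) ->
  (0 < f)%N -> uniq zs' -> {subset zs' <= zs} -> {in zs', forall z, z ^+ (3 ^ f) = z} ->
  (size zs' * w.+1 <= 3 ^ f)%N.
Proof.
move=> C_shifts uniq_zs hE charT rank_ge coinP f_gt0 uniq_zs' sub_zs' fix_zs'.
have g_neq0 : toL g != 0 by rewrite monic_neq0 ?monic_map ?char_poly_monic.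
pose above (z : L) (A : seq L) := uniq A /\
  forall x, x \in A = (root (toL g) x && ((toL T).[x] == z)).
have coins z A : z \in zs -> above z A -> (\sum_(x <- A) mup x (toL g) = 3 ^ (t + w))%N ->
    (w < \sum_(x <- A) m x)%N /\ ((\sum_(x <- A) m x)%N = w.+1 ->
      size A = w.+1 /\ {in A &, injective (fun x => mup x (toL g))}).
  move=> z_zs [uniqA memA] sumA.
  have eE : {in A, forall x, exists2 i, (i <= w)%N &
      mup x (toL g) = (3 ^ t * coin i * m x)%N}.
    by move=> x; rewrite memA => /andP[gx /eqP Tx]; apply: coinP; rewrite ?Tx.
  apply: (coin_change_points uniqA _ eE sumA) => x xA.
  have gx : root (toL g) x by move: xA; rewrite memA => /andP[].
  have : (0 < mup x (toL g))%N by rewrite -XsubC_dvd // dvdp_XsubCl.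
  by have [i _ ->] := eE x xA; rewrite muln_gt0 => /andP[].
have fibre z : z \in zs -> exists A, [/\ above z A, size A = w.+1 &
    {in A &, injective (fun x => mup x (toL g))}].
  move=> z_zs; have [|z' A z'_zs abA|A abA [sumA summ]] :=
    @points_over 3 L phi n w.+1 _ C T h zs isT C_shifts uniq_zs hE charT _ rank_ge _ z z_zs.
  - by rewrite expn_gt0.
  - by case/(coins z' A z'_zs abA).
  by exists A; have [_ /(_ summ)[]] := coins z A z_zs abA sumA.
have pcharL : 3%N \in [pchar L] by apply: (pchar_closure phi).
have fixed z A : z \in zs' -> above z A ->
    {in A &, injective (fun x => mup x (toL g))} ->
    {in A, forall x, x ^+ (3 ^ f) = x}.
  move=> z_zs' [_ memA] injA x xA; have [gx Tx mx] := iter_pFrobenius T x f pcharL g_neq0.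
  apply: injA; rewrite ?mx //.
  by move: xA; rewrite !memA gx Tx => /andP[-> /eqP->]; rewrite fix_zs' //=.
(* The fibres over distinct [z] are disjoint because [T] takes different values on them, so they can
   be concatenated. *)
have [X [uniqX memX sizeX]] : exists X : seq L, [/\ uniq X,
    forall x, x \in X -> x ^+ (3 ^ f) = x /\ (toL T).[x] \in zs' &
    size X = (size zs' * w.+1)%N].
  elim: zs' uniq_zs' sub_zs' {fix_zs'} fixed => [|z s IHs] /=.
    by move=> _ _ _; exists [::].
  case/andP=> zNs uniq_s sub_s fixed.
  have [|z1 A1 z1_s|X [uniqX memX sizeX]] := IHs uniq_s.
  - by move=> y ys; apply: sub_s; rewrite inE ys orbT.
  - by apply: fixed; rewrite inE z1_s orbT.
  have [|A [abA sizeA injA]] := fibre z; first by apply: sub_s; rewrite inE eqxx.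
  have fixA := fixed z A (mem_head _ _) abA injA; have [uniqA memA] := abA.
  exists (A ++ X); rewrite size_cat sizeA sizeX mulSn; split=> // [|x].
    rewrite cat_uniq uniqA uniqX andbT; apply/hasPn => x /memX[_ Txs].
    by apply: contraNN zNs => /=; rewrite memA => /andP[_ /eqP <-].
  rewrite mem_cat => /orP[xA|/memX[-> Txs]]; last by rewrite inE Txs orbT.
  split; first exact: fixA.
  by move: xA; rewrite memA inE => /andP[_ ->].
rewrite -sizeX; apply: size_fixed_le uniqX _ => [|x /memX[] //].
by case: (f) f_gt0 => // k _; rewrite expnS (leq_trans _ (leq_pmulr _ _)) ?expn_gt0.
Qed.

(** * The corank of pi modulo p *)

Lemma horner_mx_comp (R : comNzRingType) (n : nat) (C : 'M[R]_n.+1) (h T : {poly R}) :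
  horner_mx C (h \Po T) = horner_mx (horner_mx C T) h.
Proof.
elim/poly_ind: h => [|h c IHh]; first by rewrite comp_poly0 !rmorph0.
rewrite comp_polyD comp_polyM comp_polyX comp_polyC !rmorphD !rmorphM /= IHh.
by rewrite !horner_mx_C horner_mx_X.
Qed.

Lemma size_XnsubC_succ (R : nzRingType) (K : nat) (c : R) :
  size ('X^(K.+1) - c%:P : {poly R}) = K.+2.
Proof.
by rewrite size_polyDl size_polyXn // size_polyN
  (leq_ltn_trans (size_polyC_leq1 _)).
Qed.

(* Up to sign, [h'(Theta)] and [F(Z)] have the same determinant, where [Theta]
   and [Z] are matrices with characteristic polynomials [F] and
   [h' = 'X^K - (s + p t)]; the latter is [p ^ v] times a matrix invertible
   mod [p]. *)
Lemma corank_le (p n K q m v : nat) (a b s t a' b' : int)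
    (C : 'M[int]_n.+1) (T : {poly int}) :
  prime p -> char_poly (horner_mx C T) = trinomial (K.+1 * q) m a b ->
  a = p%:Z ^+ v * a' -> (s + p%:Z * t) ^+ q + b = p%:Z ^+ v * b' ->
  (p%:Z %| a')%Z (+) (p%:Z %| b')%Z -> ~~ (p%:Z %| s)%Z ->
  (n < \rank (map_mx (intr : int -> 'F_p)
        (horner_mx C (('X^(K.+1) - s%:P) \Po T))) + K.+1 * v)%N.
Proof.
move=> p_pr charF aE bE ab_xor sNp.
pose red : {rmorphism int -> 'F_p} := intr.
have red0 z : (red z == 0) = (p%:Z %| z)%Z by rewrite (@intr_eq0_pchar _ p) ?pchar_Fp.
have redp : red p%:Z = 0 by apply/eqP; rewrite red0 dvdzz.
pose S := s + p%:Z * t; pose h' : {poly int} := 'X^(K.+1) - S%:P.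
have redS : red S = red s by rewrite rmorphD rmorphM redp mul0r addr0.
have [|Z charZ _] := @companion_exists _ K.+1 h' _ (size_XnsubC_succ K S).
  by rewrite monicXnsubC.
set M := horner_mx C _.
have redM : map_mx red M = map_mx red (horner_mx C (h' \Po T)).
  rewrite /M !map_horner_mx !map_comp_poly; congr (horner_mx _ (_ \Po _)).
  by rewrite /h' !rmorphB /= !map_polyC /= redS.
rewrite -/red redM -leq_subLR.
have ZK : Z ^+ K.+1 = S%:M.
  have := Cayley_Hamilton Z; rewrite charZ rmorphB rmorphXn /= horner_mx_X.
  by rewrite horner_mx_C => /eqP; rewrite subr_eq0 => /eqP.
have FZ : horner_mx Z (trinomial (K.+1 * q) m a b) =
          (p%:Z ^+ v) *: (b'%:M + a' *: Z ^+ m).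
  rewrite !rmorphD /= horner_mxZ !rmorphXn /= horner_mx_X !horner_mx_C.
  rewrite exprM ZK -rmorphXn /= -addrA [_ + b%:M]addrC addrA -raddfD /= bE.
  by rewrite scalerDr scale_scalar_mx scalerA -aE.
(* Exactly one of the two terms survives modulo [p]. If it is the power of [Z], then [Z] has to be
   invertible modulo [p]: the constant term of its characteristic polynomial is [- S], prime to
   [p]. *)
have detU : ~~ (p%:Z %| \det (b'%:M + a' *: Z ^+ m))%Z.
  rewrite -red0 -det_map_mx map_mxD map_scalar_mx map_mxZ rmorphXn /=.
  have detZ_neq0 : \det (map_mx red Z) != 0.
    rewrite det_map_mx red0; apply: contra sNp => p_detZ.
    rewrite -red0 -redS -oppr_eq0 -rmorphN red0.
    have -> : - S = (char_poly Z).[0].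
      by rewrite charZ !hornerE expr0n /= sub0r.
    by rewrite horner_char_poly raddf0 sub0r -scaleN1r detZ dvdz_mull.
  have : (red a' == 0) (+) (red b' == 0) by rewrite !red0.
  have [->|a'_neq0] := eqVneq (red a') 0; rewrite /=.
    by move=> b'_neq0; rewrite scale0r addr0 det_scalar expf_neq0.
  move=> /eqP->; rewrite raddf0 add0r detZ mulf_neq0 ?expf_neq0 //.
  elim: (m) => [|j IHj]; first by rewrite expr0 det1 oner_neq0.
  by rewrite exprS det_mulmx mulf_neq0.
have [e] := det_char_poly_sym (horner_mx C T) Z.
rewrite -horner_mx_comp charZ charF FZ detZ -exprM => detE.
have := dvdz_det_corank (horner_mx C (h' \Po T)) p_pr.
rewrite detE => dvd_det.
have : (p%:Z ^+ (n.+1 - \rank (map_mx red (horner_mx C (h' \Po T))))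
    %| p%:Z ^+ (v * K.+1))%Z.
  have copU : coprimez (p%:Z ^+ (n.+1 - \rank (map_mx red (horner_mx C (h' \Po T)))))
      ((-1) ^+ e * \det (b'%:M + a' *: Z ^+ m)).
    rewrite coprimezE abszX coprimeXl // prime_coprime // abszMsign.
    exact: detU.
  by rewrite -(Gauss_dvdzr _ copU) -mulrA [\det _ * _]mulrC.
rewrite dvdzE !abszX dvdn_Pexp2l ?prime_gt1 // => le_corank.
by rewrite mulnC; move: le_corank; rewrite !leq_subLR addnC.
Qed.

(** * Binomial coefficients and the Newton polygon of a [p ^ r]-th power *)

(** By [j * 'C(p ^ r, j) = p ^ r * 'C((p ^ r).-1, j.-1)] the valuation is at least [r - logn p j],
    and [j < p ^ (r - i)] forces [logn p j < r - i]. *)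
Lemma dvdn_bin_pexp (p r i j : nat) : prime p -> (i <= r)%N ->
  (0 < j < p ^ (r - i))%N -> (p ^ i.+1 %| 'C(p ^ r, j))%N.
Proof.
move=> p_pr le_ir /andP[j_gt0 j_lt].
have le_jq : (j <= p ^ r)%N.
  by rewrite ltnW // (leq_trans j_lt) // leq_exp2l ?prime_gt1 // leq_subr.
have bin_gt : (0 < 'C(p ^ r, j))%N by rewrite bin_gt0.
rewrite pfactor_dvdn //.
have le_j1 : (j.-1 <= (p ^ r).-1)%N by lia.
have := congr1 (logn p) (mul_bin_diag (p ^ r) j.-1).
rewrite prednK // lognM ?bin_gt0 ?expn_gt0 ?(prime_gt0 p_pr) //.
rewrite lognM // pfactorK // => log_eq.
have log_j : (logn p j < r - i)%N.
  rewrite -(ltn_exp2l _ _ (prime_gt1 p_pr)) (leq_ltn_trans _ j_lt) //.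
  by rewrite dvdn_leq // pfactor_dvdnn.
by lia.
Qed.

(** By Pascal's rule and the divisibility of ['C(p ^ r, j.+1)], consecutive entries of this row are
    opposite modulo [p], starting from 1. *)
Lemma ndvdn_bin_pexp_pred (p r j : nat) : prime p -> (j < p ^ r)%N ->
  ~~ (p %| 'C((p ^ r).-1, j))%N.
Proof.
move=> p_pr; elim: j => [|j IHj] lt_j.
  by rewrite bin0 dvdn1 neq_ltn prime_gt1 ?orbT.
have : (p %| 'C(p ^ r, j.+1))%N.
  by have := @dvdn_bin_pexp p r 0 j.+1 p_pr (leq0n _); rewrite subn0 expn1; apply.
rewrite -[(p ^ r)%N]prednK ?expn_gt0 ?prime_gt0 // binS => dvd_sum.
apply: contra (IHj (ltnW lt_j)) => dvd_bin.
by rewrite -(dvdn_addr _ dvd_bin).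
Qed.

Lemma bin_pexp_pexp (p r i : nat) : prime p -> (i <= r)%N ->
  exists2 c, 'C(p ^ r, p ^ (r - i)) = (p ^ i * c)%N & ~~ (p %| c)%N.
Proof.
move=> p_pr le_ir; have p_gt0 := prime_gt0 p_pr.
exists 'C((p ^ r).-1, (p ^ (r - i)).-1).
  apply/eqP; rewrite -(eqn_pmul2l (_ : 0 < p ^ (r - i))%N) ?expn_gt0 ?p_gt0 //.
  rewrite mulnA -expnD subnK // mul_bin_diag prednK ?expn_gt0 ?p_gt0 //.
apply: ndvdn_bin_pexp_pred => //; rewrite prednK ?expn_gt0 ?p_gt0 //.
by rewrite leq_exp2l ?prime_gt1 // leq_subr.
Qed.

Lemma coef_XaddC_exp (s : int) (q j : nat) :
  (('X + s%:P) ^+ q)`_j = s ^+ (q - j) *+ 'C(q, j).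
Proof.
have -> : ('X + s%:P) ^+ q = \poly_(j < q.+1) (s ^+ (q - j) *+ 'C(q, j)).
  rewrite addrC exprDn poly_def; apply: eq_bigr => i _.
  by rewrite -mul_polyC -polyC_exp polyCMn mulrnAl.
rewrite coef_poly; case: ltnP => // lt_qj; by rewrite bin_small.
Qed.

Section NewtonPolygon.

Variables (p r : nat) (s : int).
Hypotheses (p_pr : prime p) (sNp : ~~ (p%:Z %| s)%Z).
Local Notation q := (p ^ r)%N.
Local Notation f := (('X + s%:P) ^+ q : {poly int}).

Lemma pexp_dvd_coef (i j : nat) : (i <= r)%N -> (0 < j < p ^ (r - i))%N ->
  (p%:Z ^+ i.+1 %| f`_j)%Z.
Proof.
move=> le_ir j_bounds; rewrite coef_XaddC_exp -mulr_natl dvdz_mulr //.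
by rewrite dvdzE abszX natz dvdn_bin_pexp.
Qed.

(** The vertices of the Newton polygon sit at the exponents [p ^ (r - i)], with height [i]. To the
    left of such a vertex, every coefficient but the constant one is a multiple of [p ^ i.+1]. *)
Lemma lower_part (i : nat) : (i <= r)%N ->
  exists2 l : {poly int}, l`_0 = 0 &
    f = (s ^+ q)%:P + p%:Z ^+ i.+1 *: l + drop_poly (p ^ (r - i)) f * 'X^(p ^ (r - i)).
Proof.
move=> le_ir; have b_gt0 : (0 < p ^ (r - i))%N by rewrite expn_gt0 prime_gt0.
have p_neq0 : p%:Z != 0 by rewrite -lt0n prime_gt0.
have [j|l lE] := @poly_int_dvd (p%:Z ^+ i.+1) (take_poly (p ^ (r - i)) f - (s ^+ q)%:P).
  rewrite coefB coefC coef_take_poly; case: j => [|j].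
    by rewrite b_gt0 coef_XaddC_exp subn0 bin0 subrr dvdz0.
  by rewrite subr0; case: ltnP => [lt_j|_]; rewrite ?dvdz0 // pexp_dvd_coef.
exists l.
  have /polyP/(_ 0%N) := lE; rewrite coefB coefC coef_take_poly b_gt0 coefZ.
  rewrite coef_XaddC_exp subn0 bin0 subrr => /esym/eqP.
  by rewrite mulf_eq0 expf_eq0 (negPf p_neq0) andbF => /eqP.
by rewrite -lE [_%:P + (_ - _)]addrC subrK poly_take_drop.
Qed.

(** This is the slice of [f] between two neighbouring vertices. The coefficient at its left end has
    valuation exactly [i.+1], whence the condition on the constant term of [u]. *)
Lemma middle_part (i : nat) : (i < r)%N ->
  exists2 u : {poly int}, ~~ (p%:Z %| u`_0)%Z &
    drop_poly (p ^ (r - i.+1)) f = p%:Z ^+ i.+1 *: u +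
      drop_poly (p ^ (r - i)) f * 'X^(p.-1 * p ^ (r - i.+1)).
Proof.
move=> lt_ir; set N := (p.-1 * _)%N; set b := (p ^ (r - i.+1))%N.
have p_gt0 := prime_gt0 p_pr.
have bN : (p ^ (r - i) = b + N)%N.
  rewrite /N -mulSn prednK // -expnS; congr expn; lia.
have N_gt0 : (0 < N)%N.
  by rewrite muln_gt0 expn_gt0 p_gt0 andbT -ltnS prednK // prime_gt1.
have b_gt0 : (0 < b)%N by rewrite expn_gt0 p_gt0.
have p_neq0 : p%:Z != 0 by rewrite -lt0n.
have [j|u uE] := @poly_int_dvd (p%:Z ^+ i.+1) (take_poly N (drop_poly b f)).
  rewrite coef_take_poly; case: ltnP => [lt_j|_]; rewrite ?dvdz0 // coef_drop_poly.
  by rewrite pexp_dvd_coef ?(ltnW lt_ir) // bN; lia.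
exists u; last first.
  rewrite -uE bN -[LHS](poly_take_drop N); congr (_ + _ * _).
  by apply/polyP => j; rewrite !coef_drop_poly; congr (_`_ _); lia.
have /polyP/(_ 0%N) := uE; rewrite coef_take_poly N_gt0 coef_drop_poly coefZ add0n.
rewrite coef_XaddC_exp; have [c -> cNp] := @bin_pexp_pexp p r i.+1 p_pr lt_ir.
rewrite mulrnA -[_ *+ (p ^ i.+1)]mulr_natl natrX natz -mulrnAr.
move/mulfI=> <-; last by rewrite expf_eq0 (negPf p_neq0) andbF.
rewrite -mulr_natr natz dvdzE abszM Euclid_dvdM // negb_or cNp andbT.
by rewrite abszX Euclid_dvdX // negb_and -[(_ %| _)%N]/(_ %| _)%Z sNp.
Qed.

Lemma top_part : drop_poly q f = 1.
Proof.
apply/polyP => j; rewrite coef_drop_poly coef_XaddC_exp coef1.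
by case: j => [|j]; rewrite ?binn ?subnn ?expr0 // bin_small // addSn ltnS leq_addl.
Qed.

End NewtonPolygon.

(** * Integrality of the Newton quotients *)

Lemma integral_eval (K : fieldType) (A : {poly int}) (x : K) :
  integralOver (intr : int -> K) x ->
  integralOver (intr : int -> K) (map_poly intr A).[x].
Proof.
move=> int_x; apply: integral_horner => //.
by apply/integral_poly => i; rewrite coef_map; apply: integral_id.
Qed.

Lemma integral_exp (K : fieldType) (x : K) (k : nat) :
  integralOver (intr : int -> K) x -> integralOver (intr : int -> K) (x ^+ k).
Proof.
move=> int_x; elim: k => [|k IHk]; first by rewrite expr0; apply: integral1.
by rewrite exprS; apply: integral_mul.
Qed.

Lemma integral_quadratic (K : fieldType) (x b c : K) :
  integralOver (intr : int -> K) b -> integralOver (intr : int -> K) c ->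
  x * (x - b) = c -> integralOver (intr : int -> K) x.
Proof.
move=> int_b int_c xE.
have int0 := integral0 (intr : {rmorphism int -> K}).
have int1 := integral1 (intr : {rmorphism int -> K}).
pose Q : {poly K} := Poly [:: - c; - b; 1].
have QE : polyseq Q = [:: - c; - b; 1] by rewrite (@PolyK _ 0) //= oner_neq0.
apply: (@integral_root_monic _ _ intr x Q).
- by rewrite monicE lead_coefE QE.
- by rewrite /root horner_Poly /= -xE; apply/eqP; ring.
move=> y; rewrite QE !inE => /or3P[] /eqP->; rewrite ?int1 //; exact: integral_opp.
Qed.

(* The quotients [eps i] of the Newton polygon of [F] in powers of [pi] are
   integral: each one satisfies a monic quadratic equation over the ring
   generated by [theta] and the preceding one. *)
Lemma newton_relations (p r w m : nat) (s a b a' b' : int) (K : fieldType)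
    (theta pi : K) (ev := fun A : {poly int} => (map_poly (intr : int -> K) A).[pi]) :
  prime p -> p%:R != 0 :> K -> ~~ (p%:Z %| s)%Z -> (w <= r)%N ->
  a = p%:Z ^+ w.+1 * a' -> s ^+ (p ^ r) + b = p%:Z ^+ w.+1 * b' ->
  (pi + s%:~R) ^+ (p ^ r) + a%:~R * theta ^+ m + b%:~R = 0 ->
  integralOver (intr : int -> K) theta -> integralOver (intr : int -> K) pi ->
  exists eps : nat -> K,
  [/\ eps 0%N = 1,
      forall i, (i <= w)%N -> integralOver (intr : int -> K) (eps i),
      forall i, (i < w)%N -> exists2 u : {poly int}, ~~ (p%:Z %| u`_0)%Z &
        eps i * pi ^+ (p.-1 * p ^ (r - i.+1)) = p%:R * (eps i.+1 - ev u) &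
      exists2 l : {poly int}, l`_0 = 0 &
        eps w * pi ^+ (p ^ (r - w)) =
          - p%:R * (ev l + (b'%:~R + a'%:~R * theta ^+ m))].
Proof.
move=> p_pr p_neq0 sNp le_wr aE bE F0 int_theta int_pi.
pose f : {poly int} := ('X + s%:P) ^+ (p ^ r).
(* The part of [f] from the vertex at [p ^ (r - i)] on, divided by [p] to the height of that
   vertex. *)
pose eps i := ev (drop_poly (p ^ (r - i)) f) / p%:R ^+ i.
have evD A B : ev (A + B) = ev A + ev B by rewrite /ev rmorphD hornerD.
have evM A B : ev (A * B) = ev A * ev B by rewrite /ev rmorphM hornerM.
have evC c : ev c%:P = c%:~R by rewrite /ev map_polyC hornerC.
have evXn k : ev 'X^k = pi ^+ k by rewrite /ev map_polyXn hornerXn.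
have evZ k A : ev (p%:Z ^+ k *: A) = p%:R ^+ k * ev A.
  by rewrite -mul_polyC evM evC rmorphXn.
have evf : ev f = (pi + s%:~R) ^+ (p ^ r).
  by rewrite /ev rmorphXn /= rmorphD /= map_polyX map_polyC horner_exp !hornerE.
(* Here [F0] turns the power of [pi + s] into the lower terms of the trinomial; together with
   [s ^+ (p ^ r)] these are divisible by [p ^ w.+1]. *)
have rel_low i : (i <= w)%N -> exists2 l : {poly int}, l`_0 = 0 &
    eps i * pi ^+ (p ^ (r - i)) =
      - p%:R * (ev l + p%:R ^+ (w - i) * (b'%:~R + a'%:~R * theta ^+ m)).
  move=> le_iw; have [l l0 fE] := lower_part s p_pr (leq_trans le_iw le_wr).
  exists l => //; have := congr1 ev fE.
  rewrite !evD evM evXn evC evZ -/f evf => {}fE.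
  have pi_neq0 : p%:R ^+ i != 0 :> K by rewrite expf_neq0.
  apply: (mulfI pi_neq0); rewrite /eps mulrAC mulrCA divff // mulr1.
  have -> : ev (drop_poly (p ^ (r - i)) f) * pi ^+ (p ^ (r - i)) =
      (pi + s%:~R) ^+ (p ^ r) - (s ^+ (p ^ r))%:~R - p%:R ^+ i.+1 * ev l.
    by rewrite fE; ring.
  have -> : (pi + s%:~R) ^+ (p ^ r) = - (a%:~R * theta ^+ m + b%:~R).
    by apply/eqP; rewrite -addr_eq0 addrA F0.
  have bK : (s ^+ (p ^ r))%:~R = p%:R ^+ w.+1 * b'%:~R - b%:~R :> K.
    by rewrite -[p%:R]/(p%:Z%:~R) -rmorphXn -rmorphM -bE rmorphD addrK.
  have aK : a%:~R = p%:R ^+ w.+1 * a'%:~R :> K.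
    by rewrite aE rmorphM rmorphXn.
  have pwE : p%:R ^+ w.+1 = p%:R ^+ i.+1 * p%:R ^+ (w - i) :> K.
    by rewrite -exprD addSn subnKC.
  by rewrite bK aK pwE exprS; ring.
have rel_mid i : (i < w)%N -> exists2 u : {poly int}, ~~ (p%:Z %| u`_0)%Z &
    eps i * pi ^+ (p.-1 * p ^ (r - i.+1)) = p%:R * (eps i.+1 - ev u).
  move=> lt_iw; have [u uNp fE] := middle_part p_pr sNp (leq_trans lt_iw le_wr).
  exists u => //; have := congr1 ev fE; rewrite -/f evD evM evXn evZ => {}fE.
  have pi_neq0 : p%:R ^+ i != 0 :> K by rewrite expf_neq0.
  rewrite /eps fE exprS; move: (p%:R ^+ i : K) pi_neq0 => pi' pi_neq0.
  by field; rewrite p_neq0 pi_neq0.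
have eps0 : eps 0%N = 1 by rewrite /eps subn0 top_part evC expr0 divr1.
exists eps; split=> //; last first.
  by have [l l0 ->] := rel_low w (leqnn w); exists l; rewrite // subnn expr0 mul1r.
have int_int z : integralOver (intr : int -> K) z%:~R by apply: integral_id.
have int_ev A : integralOver (intr : int -> K) (ev A) by apply: integral_eval.
elim=> [_|i IHi lt_iw]; first by rewrite eps0; apply: integral1.
have int_epsi := IHi (ltnW lt_iw).
have [u _ uE] := rel_mid i lt_iw; have [l _ lE] := rel_low i.+1 lt_iw.
set B := (p ^ (r - i.+1))%N in uE lE.
have piE : pi ^+ (p.-1 * B) = pi ^+ ((p - 2) * B) * pi ^+ B.
  rewrite -exprD -[X in (_ + X)%N]mul1n -mulnDl; congr (_ ^+ (_ * _)).
  by have := prime_gt1 p_pr; lia.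
set c := ev l + _ in lE.
(* Multiply [uE] by [eps i.+1]: the left side then contains [eps i.+1 * pi ^+ B], which [lE] shows
   to be [p] times an integral element, so a factor [p] cancels. *)
have eps_quad : eps i.+1 * (eps i.+1 - ev u) = - (eps i * (pi ^+ ((p - 2) * B) * c)).
  apply: (mulfI p_neq0); rewrite mulrCA -uE piE.
  transitivity (eps i * pi ^+ ((p - 2) * B) * (eps i.+1 * pi ^+ B)); first by ring.
  by rewrite lE; ring.
apply: integral_quadratic (int_ev u) _ eps_quad.
apply: integral_opp; apply: integral_mul => //; apply: integral_mul.
  exact: integral_exp.
apply: integral_add => //; apply: integral_mul; first exact/integral_exp/integral_nat.
by apply: integral_add => //; apply: integral_mul => //; apply: integral_exp.
Qed.

(** * From the sides of the polygon to multiplicities *)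

(** Follow the values at [x] of [E 0 = 1], [E 1] and so on. If [E j.+1] is the first to vanish, then
    neither [E j] nor [E j.+1 - U j.+1] does, and the [j]-th relation gives the multiplicity. If
    none vanishes, the last relation gives it. *)
Lemma mup_coin (L : closedFieldType) (phi : {rmorphism 'F_3 -> L}) (r w : nat)
    (g P W : {poly int}) (E U : nat -> {poly int}) (x : L)
    (toL := map_poly (intr : int -> L)) :
  g \is monic -> toL P != 0 -> root (toL g) x -> root (toL P) x -> (w <= r)%N ->
  E 0%N = 1 ->
  (forall i, (i < w)%N -> exists Q,
     E i * P ^+ (2 * 3 ^ (r - i.+1)) = 3 *: (E i.+1 - U i.+1) + g * Q) ->
  (exists Q, E w * P ^+ (3 ^ (r - w)) = 3 *: W + g * Q) ->
  (forall i, (i < w)%N -> ~~ root (toL (U i.+1)) x) ->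
  ((w < r)%N -> ~~ root (toL W) x) ->
  exists2 i, (i <= w)%N & mup x (toL g) =
    (3 ^ (r - w) * coin i * minn (mup x (toL g)) (mup x (toL P)))%N.
Proof.
move=> g_monic P_neq0 gx Px le_wr E0 rel_mid [Qw rel_low] Ux Wx.
have main i N V Q : (0 < N)%N -> E i * P ^+ N = 3 *: V + g * Q ->
    ~~ root (toL (E i)) x -> (1 < N)%N ==> ~~ root (toL V) x ->
    mup x (toL g) = (N * minn (mup x (toL g)) (mup x (toL P)))%N.
  by move=> N_gt0 rel Ex Vx; apply: (mup_minn_eq phi _ g_monic N_gt0 rel).
have exp3_gt0 j : (0 < 3 ^ j)%N by rewrite expn_gt0.
have step i : (i <= w)%N -> (exists2 j, (j < w)%N &
      ~~ root (toL (E j)) x && ~~ root (toL (E j.+1 - U j.+1)) x)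
    \/ ~~ root (toL (E i)) x.
  elim: i => [_|i IHi lt_iw].
    by right; rewrite E0 /toL rmorph1 root1.
  case: (IHi (ltnW lt_iw)) => [ex|Ex]; first by left.
  have [E1x|E1x] := boolP (root (toL (E i.+1)) x); last by right.
  left; exists i; rewrite // Ex /= /toL rmorphB /= rootE !hornerE (rootP E1x).
  by rewrite sub0r oppr_eq0; apply: Ux.
case: (step w (leqnn w)) => [[j lt_jw /andP[Ej Ej1]]|Ew].
  (* Coins are numbered from the left end of the polygon and the [E j] from the right end, hence the
     reversal. *)
  exists (w - j)%N; first exact: leq_subr.
  have [Q rel] := rel_mid j lt_jw.
  have -> : (3 ^ (r - w) * coin (w - j) = 2 * 3 ^ (r - j.+1))%N.
    have -> : (r - j.+1 = (r - w) + (w - j.+1))%N by lia.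
    by rewrite -(subnSK lt_jw) /coin expnD mulnCA.
  apply: main rel Ej _; first by rewrite muln_gt0 exp3_gt0.
  by rewrite Ej1 implybT.
exists 0%N => //; rewrite muln1; apply: main rel_low Ew _ => //.
have [->|lt_wr] := eqVneq w r; first by rewrite subnn.
by apply/implyP => _; apply: Wx; rewrite ltn_neqAle lt_wr.
Qed.

(** * Trinomials and minimal polynomials over the integers *)

Lemma size_trinomial (n m : nat) (a b : int) : (1 <= m < n)%N ->
  trinomial n m a b \is monic /\ size (trinomial n m a b) = n.+1.
Proof.
move=> /andP[m_gt0 lt_mn].
have size_low : (size (a *: 'X^m + b%:P)%R < n.+1)%N.
  rewrite ltnS (leq_trans (size_polyD _ _)) // geq_max.
  rewrite (leq_trans (size_scale_leq _ _)) ?size_polyXn //=.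
  exact: leq_trans (size_polyC_leq1 b) (leq_trans m_gt0 (ltnW lt_mn)).
rewrite /trinomial -addrA; split; last by rewrite size_polyDl size_polyXn.
by rewrite monicE lead_coefDl ?lead_coefXn ?size_polyXn.
Qed.

Lemma fieldExt_intr_inj (K : fieldExtType rat) : injective (intr : int -> K).
Proof.
move=> y z; rewrite -!(rmorph_int (in_alg K)) => /fmorph_inj; exact: intr_inj.
Qed.

(** Gauss's lemma: the minimal polynomial divides a monic integer polynomial, so up to a scalar it
    is an integer factor with leading coefficient 1 or -1; [e] corrects the sign. *)
Lemma integral_minPoly (K : fieldExtType rat) (eta : K) :
  integralOver (intr : int -> K) eta ->
  exists2 g : {poly int}, g \is monic & minPoly 1 eta = map_poly intr g.
Proof.
move=> [P0 P0_monic P0eta].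
have in_algE := map_poly_intr_rmorph (in_alg K).
have /polyOver1P[mu muE] := minPolyOver 1 eta.
have mu_monic : mu \is monic by rewrite -(map_monic (in_alg K)) -muE monic_minPoly.
have : minPoly 1 eta %| map_poly intr P0.
  by apply: minPoly_dvdp P0eta; rewrite -in_algE; apply/polyOver1P; exists (map_poly intr P0).
rewrite muE -in_algE dvdp_map => /dvdpP_rat_int[g1 [c c_neq0 mu_g1] [h P0E]].
pose e := lead_coef g1.
have e2 : e * e = 1.
  have : lead_coef h * e = 1 by rewrite mulrC -lead_coefM -P0E (monicP P0_monic).
  by move/intUnitRing.unitzPl/orP => [] /eqP->.
have ce : c * e%:~R = 1.
  have := monicP mu_monic; rewrite mu_g1 lead_coefZ lead_coef_map_inj //.
  exact: intr_inj.
have cE : c = e%:~R.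
  have e2Q : e%:~R * e%:~R = 1 :> rat by rewrite -rmorphM e2.
  by rewrite -[LHS]mulr1 -[X in _ * X]e2Q mulrA ce mul1r.
exists (e *: g1); first by rewrite monicE lead_coefZ e2.
by rewrite mu_g1 cE -map_polyZ in_algE.
Qed.

(** Division by the monic [g] stays over the integers, and the remainder vanishes at [eta] with
    degree less than that of the minimal polynomial. *)
Lemma minPoly_dvd_int (K : fieldExtType rat) (eta : K) (g A : {poly int}) :
  g \is monic -> minPoly 1 eta = map_poly intr g ->
  (map_poly (intr : int -> K) A).[eta] = 0 -> exists Q, A = g * Q.
Proof.
move=> g_monic gE Aeta; set toK := map_poly (intr : int -> K) in Aeta gE.
have toK_inj : injective toK by apply: map_inj_poly => //; apply: fieldExt_intr_inj.
have in_algE := map_poly_intr_rmorph (in_alg K).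
pose R := Pdiv.CommonRing.rmodp A g.
have AE := Pdiv.RingMonic.rdivp_eq g_monic A; rewrite -/R in AE.
have geta : (toK g).[eta] = 0 by rewrite -gE minPolyxx.
have Reta : root (toK R) eta.
  by move: Aeta; rewrite AE /toK rmorphD rmorphM /= -/toK hornerD hornerM geta mulr0 add0r => /rootP.
have dvdR : toK g %| toK R.
  rewrite -gE; apply: minPoly_dvdp Reta; rewrite /toK -in_algE.
  by apply/polyOver1P; exists (map_poly intr R).
have R0 : R = 0.
  apply/eqP; apply: contraTT dvdR => R_neq0; rewrite gtNdvdp //.
    by rewrite -(rmorph0 (map_poly (intr : {rmorphism int -> K}))) (inj_eq toK_inj).
  rewrite !(size_map_inj_poly (@fieldExt_intr_inj K)) //.
  exact: Pdiv.CommonRing.ltn_rmodpN0 (monic_neq0 g_monic).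
by exists (Pdiv.CommonRing.rdivp A g); rewrite {1}AE R0 addr0 mulrC.
Qed.

(** The minimal polynomial of [A] is nonconstant and divides the irreducible [F], so [F] divides the
    characteristic polynomial; both are monic of the same degree. *)
Lemma char_poly_irreducible (n : nat) (A : 'M[int]_n.+1) (F : {poly int}) :
  F \is monic -> size F = n.+2 -> irreducible_over_Q F -> horner_mx A F = 0 ->
  char_poly A = F.
Proof.
move=> F_monic sizeF F_irr FA; pose toQ : {rmorphism int -> rat} := intr.
have FAQ : horner_mx (map_mx toQ A) (map_poly toQ F) = 0.
  by rewrite -map_horner_mx FA raddf0.
have mu_F := mxminpoly_min FAQ.
have eqF : mxminpoly (map_mx toQ A) %= map_poly toQ F.
  by apply: F_irr.2 mu_F; rewrite size_mxminpoly eqSS -lt0n mxminpoly_nonconstant.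
have F_char : map_poly toQ F %| char_poly (map_mx toQ A).
  by rewrite -(eqp_dvdl _ eqF) mxminpoly_dvd_char.
apply: (map_inj_poly (@intr_inj rat) (rmorph0 toQ)).
rewrite [LHS]map_char_poly; apply/esym/eqP.
rewrite -eqp_monic ?char_poly_monic ?monic_map //.
by rewrite -dvdp_size_eqp // size_char_poly size_map_inj_poly ?sizeF //; apply: intr_inj.
Qed.

(** As [theta] is a polynomial in [eta], also [eta] generates [K], and both minimal polynomials have
    degree the dimension of [K]. *)
Lemma size_minPoly_generator (K : fieldExtType rat) (theta eta : K) (F T : {poly int}) :
  irreducible_over_Q F -> root (map_poly (intr : int -> K) F) theta ->
  <<1; theta>>%VS = {:K}%VS -> theta = (map_poly (intr : int -> K) T).[eta] ->
  size (minPoly 1 eta) = size F.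
Proof.
move=> [F_size F_irr] Ftheta K_gen thetaE.
have in_algE := map_poly_intr_rmorph (in_alg K).
have eta_gen : <<1; eta>>%VS = {:K}%VS.
  apply/eqP; rewrite eqEsubv subvf -K_gen sub_adjoin1v.
  by apply/Fadjoin1_polyP; exists (map_poly intr T); rewrite in_algE.
have -> : size (minPoly 1 eta) = size (minPoly 1 theta).
  by rewrite !size_minPoly !adjoin_degreeE eta_gen K_gen.
have /polyOver1P[mu muE] := minPolyOver 1 theta.
have mu_F : mu %| map_poly intr F.
  rewrite -(dvdp_map (in_alg K)) -muE in_algE; apply: minPoly_dvdp Ftheta.
  by rewrite -in_algE; apply/polyOver1P; exists (map_poly intr F).
have size_mu : size (minPoly 1 theta) = size mu by rewrite muE size_map_poly.
have /F_irr/(_ mu_F) : size mu != 1%N.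
  by rewrite -size_mu size_minPoly.
by move/eqp_size; rewrite size_mu => ->; rewrite (size_map_inj_poly (@intr_inj rat)).
Qed.

(** * From a generator of the ring of integers to a contradiction *)

Lemma uniq_roots_XnsubC (L : closedFieldType) (n : nat) (c : L) :
  (0 < n)%N -> n%:R != 0 :> L -> c != 0 ->
  exists2 zs, uniq zs & 'X^n - c%:P = \prod_(z <- zs) ('X - z%:P).
Proof.
move=> n_gt0 n_neq0 c_neq0; have [zs hE] := closed_field_poly_normal ('X^n - c%:P).
rewrite (monicP (monicXnsubC c n_gt0)) scale1r in hE.
exists zs; rewrite // -separable_prod_XsubC -hE unlock.
(* Multiplying the derivative by ['X] and subtracting [n] times the polynomial leaves the nonzero
   constant [n * c]. *)
apply/Bezout_coprimepP; exists (- n%:R%:P, 'X) => /=.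
rewrite derivB derivXn derivC subr0 mulrnAr -exprS prednK //.
suff -> : - n%:R%:P * ('X^n - c%:P) + 'X^n *+ n = (n%:R * c)%:P.
  by rewrite -size_poly_eq1 size_polyC mulf_neq0.
by rewrite -mulr_natl polyCM polyC_natr; ring.
Qed.

Lemma exprB_pchar_pow (p r : nat) (L : fieldType) (A : {poly L}) (c : L) :
  p \in [pchar L] -> odd p -> (A - c%:P) ^+ (p ^ r) = A ^+ (p ^ r) - (c ^+ (p ^ r))%:P.
Proof.
move=> pcharL odd_p; rewrite exprDn_pchar; last first.
  by rewrite pnatX pnatE ?(pcharf_prime pcharL) // pchar_poly pcharL.
by rewrite exprNn -signr_odd oddX odd_p orbT expr1 mulN1r polyC_exp.
Qed.

Lemma ltn_succ_exp3 (j : nat) : (j.+2 < 3 ^ j.+1)%N.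
Proof. by elim: j => // j IHj; rewrite expnS; move: (3 ^ _)%N IHj => y; lia. Qed.

(** Here [w.+1] is the number of sides. Both [s] and [s + 3 * t] lift the same residue: the first
    serves for the Newton polygon, the second for the norm. The condition on [a0] and [b1] makes the
    norm valuation exactly [2 ^ k * w.+1]; the one on [a0] and [b0] governs the leftmost side, of
    length [3 ^ (r - w)]. *)
Lemma trinomial_not_monogenic (k r w f m : nat) (s a b a0 b0 t b1 : int)
    (K : fieldExtType rat) (theta : K) :
  (1 <= m < 2 ^ k * 3 ^ r)%N ->
  irreducible_over_Q (trinomial (2 ^ k * 3 ^ r) m a b) ->
  root (map_poly (intr : int -> K) (trinomial (2 ^ k * 3 ^ r) m a b)) theta ->
  <<1; theta>>%VS = {:K}%VS ->
  (0 < w <= r)%N -> ~~ (3%:Z %| s)%Z ->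
  a = 3%:Z ^+ w.+1 * a0 -> s ^+ (3 ^ r) + b = 3%:Z ^+ w.+1 * b0 ->
  (s + 3%:Z * t) ^+ (3 ^ r) + b = 3%:Z ^+ w.+1 * b1 ->
  (3%:Z %| a0)%Z (+) (3%:Z %| b1)%Z ->
  (w < r)%N ==> ((3%:Z %| a0)%Z (+) (3%:Z %| b0)%Z) -> (0 < f)%N ->
  (forall L : closedFieldType, 3 \in [pchar L] -> exists2 zs : seq L,
     uniq zs /\ (3 ^ f < size zs * w.+1)%N &
     {in zs, forall z, z ^+ (2 ^ k) = s%:~R /\ z ^+ (3 ^ f) = z}) ->
  ~ monogenic K.
Proof.
move=> m_bounds F_irr Ftheta K_gen /andP[w_gt0 le_wr] sN3 aE bE b1E xor1 xor0 f_gt0.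
move=> fixed_roots [eta [int_eta ZK]].
have [L0 [phi _]] := countable_algebraic_closure ('F_3 : countFieldType).
pose L : closedFieldType := L0; pose phiL : {rmorphism 'F_3 -> L} := phi.
have pr3 : prime 3 by [].
have pcharL : 3%N \in [pchar L] := pchar_closure phiL pr3.
set F := trinomial _ _ _ _ in F_irr Ftheta.
have [F_monic sizeF] := size_trinomial a b m_bounds; rewrite -/F in F_monic sizeF.
pose evK (A : {poly int}) := (map_poly (intr : int -> K) A).[eta].
have evD A B : evK (A + B) = evK A + evK B by rewrite /evK rmorphD hornerD.
have evB A B : evK (A - B) = evK A - evK B by rewrite /evK rmorphB hornerD hornerN.
have evM A B : evK (A * B) = evK A * evK B by rewrite /evK rmorphM hornerM.
have evX A j : evK (A ^+ j) = evK A ^+ j by rewrite /evK rmorphXn horner_exp.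
have evC c : evK c%:P = c%:~R by rewrite /evK map_polyC hornerC.
have evZ c A : evK (c *: A) = c%:~R * evK A by rewrite -mul_polyC evM evC.
have in_Zeta x : integralOver (intr : int -> K) x -> exists A, x = evK A.
  by move=> int_x; have [A] := (ZK x).1 int_x; exists A.
have int_theta : integralOver (intr : int -> K) theta by exists F.
have [T thetaE] := in_Zeta _ int_theta.
have [g g_monic gE] := integral_minPoly int_eta.
have eta_dvd A : evK A = 0 -> exists Q, A = g * Q := minPoly_dvd_int g_monic gE.
have sizeg : size g = (2 ^ k * 3 ^ r).+1.
  rewrite -sizeF -(size_minPoly_generator F_irr Ftheta K_gen thetaE) gE.
  by rewrite (size_map_inj_poly (@fieldExt_intr_inj K)).
have K0_gt0 : (0 < 2 ^ k)%N by rewrite expn_gt0.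
have [K1 K1E] : exists K1, (2 ^ k)%N = K1.+1 by exists (2 ^ k).-1; rewrite prednK.
have [n nE] : exists n, (2 ^ k * 3 ^ r)%N = n.+1.
  by exists (2 ^ k * 3 ^ r).-1; rewrite prednK // muln_gt0 K0_gt0 expn_gt0.
have [C charC C_shifts] : exists2 C : 'M[int]_n.+1, char_poly C = g & shifts C.
  by apply: companion_exists; rewrite // sizeg nE.
pose h : {poly int} := 'X^(2 ^ k) - s%:P; pose P := h \Po T.
have compE A B : evK (A \Po B) = (map_poly (intr : int -> K) A).[evK B].
  by rewrite /evK map_comp_poly horner_comp.
pose pi := theta ^+ (2 ^ k) - s%:~R.
have PE : evK P = pi.
  by rewrite compE -thetaE /h rmorphB /= map_polyXn map_polyC hornerD hornerN hornerXn hornerC.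
(* The polynomial [F \Po T] vanishes at [eta], hence is a multiple of [g]; by Cayley-Hamilton, [F]
   kills the matrix of [theta]. *)
have charF : char_poly (horner_mx C T) = F.
  apply: char_poly_irreducible => //; first by rewrite sizeF nE.
  rewrite -horner_mx_comp; have [|Q ->] := eta_dvd (F \Po T).
    by rewrite compE -thetaE; apply/eqP.
  by rewrite rmorphM /= -charC Cayley_Hamilton mul0r.
have F0 : (pi + s%:~R) ^+ (3 ^ r) + a%:~R * theta ^+ m + b%:~R = 0.
  rewrite subrK -exprM -(rootP Ftheta) /F /trinomial !rmorphD /= map_polyXn map_polyZ.
  by rewrite map_polyXn map_polyC !hornerD hornerZ !hornerXn hornerC.
have int_pi : integralOver (intr : int -> K) pi.
  by apply: integral_sub; [apply: integral_exp | apply: integral_id].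
have three_neq0 : 3%:R != 0 :> K.
  by rewrite -[3%:R]/(3%:Z%:~R) -[0]/(0%:~R) (inj_eq (@fieldExt_intr_inj K)).
have [eps [eps0 int_eps eps_mid [l l0 eps_low]]] :=
  newton_relations pr3 three_neq0 sN3 le_wr aE bE F0 int_theta int_pi.
have [E [E0 EE]] : exists E : nat -> {poly int}, E 0%N = 1 /\
    forall i, (i <= w)%N -> eps i = evK (E i).
  have /fin_all_exists[E EP] (i : 'I_w.+1) : exists A, eps i = evK A.
    by apply: in_Zeta; apply: int_eps; rewrite -ltnS.
  (* At index 0 the polynomial 1 itself is taken, as [mup_coin] asks for [E 0 = 1] and not only for
     the same value at [eta]. *)
  exists (fun i => if i is j.+1 then E (inord i) else 1); split=> // -[|i] lt_i.
    by rewrite eps0 evC.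
  by rewrite -EP inordK.
have [U UP] : exists U : nat -> {poly int}, forall i, (i < w)%N ->
    ~~ (3%:Z %| (U i.+1)`_0)%Z /\
    eps i * pi ^+ (2 * 3 ^ (r - i.+1)) =
      3%:R * (eps i.+1 - (map_poly (intr : int -> K) (U i.+1)).[pi]).
  have /fin_all_exists[U UP] (i : 'I_w) : exists u : {poly int},
      ~~ (3%:Z %| u`_0)%Z /\ eps i * pi ^+ (2 * 3 ^ (r - i.+1)) =
      3%:R * (eps i.+1 - (map_poly (intr : int -> K) u).[pi]).
    by have [u u0 uE] := eps_mid i (ltn_ord i); exists u.
  exists (fun i => if insub i.-1 is Some j then U j else 0) => i lt_i.
  by rewrite insubT; apply: (UP (Sub i lt_i)).
pose W := - ((l \Po P) + (b0%:P + a0 *: T ^+ m)).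
pose toL := map_poly (intr : int -> L).
have [zs uniq_zs zsE] : exists2 zs : seq L, uniq zs &
    'X^(2 ^ k) - (s%:~R)%:P = \prod_(z <- zs) ('X - z%:P).
  apply: uniq_roots_XnsubC => //.
    by rewrite -(dvdn_pcharf pcharL) Euclid_dvdX.
  by rewrite (intr_eq0_pchar _ pcharL).
have hE : toL h = \prod_(z <- zs) ('X - z%:P).
  by rewrite -zsE /toL rmorphB /= map_polyXn map_polyC.
have size_zs : size zs = K1.+1.
  have := size_prod_XsubC zs id; rewrite -zsE K1E size_XnsubC_succ => -[//].
have rank_ge : (n < \rank (map_mx (intr : int -> 'F_3) (horner_mx C P)) +
    size zs * w.+1)%N.
  have charF' : char_poly (horner_mx C T) = trinomial (K1.+1 * 3 ^ r) m a b.
    by rewrite charF /F K1E.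
  rewrite size_zs /P /h K1E.
  exact: corank_le pr3 charF' aE b1E xor1 sN3.
have coins x : root (toL (char_poly C)) x -> (toL T).[x] \in zs ->
    exists2 i, (i <= w)%N & mup x (toL (char_poly C)) =
    (3 ^ (r - w) * coin i * minn (mup x (toL (char_poly C))) (mup x (toL P)))%N.
  rewrite charC => gx Tx; set z := (toL T).[x] in Tx.
  have hz : (toL h).[z] = 0 by apply/rootP; rewrite hE root_prod_XsubC.
  have compL A B : (toL (A \Po B)).[x] = (toL A).[(toL B).[x]].
    by rewrite /toL map_comp_poly horner_comp.
  have Px : (toL P).[x] = 0 by rewrite compL.
  have at0 A : (toL A).[0] = (A`_0)%:~R by rewrite horner_coef0 coef_map.
  have intL0 c : (c%:~R == 0 :> L) = (3%:Z %| c)%Z := intr_eq0_pchar c pcharL.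
  have le_i i : (i < w)%N -> (i <= w)%N by exact: ltnW.
  apply: (@mup_coin L phiL r w g P W E (fun i => U i \Po P)) => //.
  (* If [P] vanished modulo 3, the corank would be [2 ^ k * 3 ^ r], which exceeds [2 ^ k * w.+1]
     because [w.+1 < 3 ^ w]. *)
  - apply: contraTneq rank_ge => P0; rewrite -leqNgt size_zs.
    have -> : map_mx (intr : int -> 'F_3) (horner_mx C P) = 0.
      rewrite map_horner_mx; suff -> : map_poly intr P = 0 :> {poly 'F_3} by rewrite rmorph0.
      apply: (map_inj_poly (fmorph_inj phiL) (rmorph0 phiL)); rewrite rmorph0 -P0.
      exact: map_poly_intr_rmorph.
    rewrite mxrank0 add0n -ltnS -nE K1E ltn_pmul2l //.
    apply: (@leq_trans (3 ^ w)); last by rewrite leq_exp2l.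
    by case: (w) w_gt0 => // j _; apply: ltn_succ_exp3.
  - exact/rootP.
  - move=> i lt_i; have [_ relK] := UP i lt_i.
    pose A : {poly int} := E i * P ^+ (2 * 3 ^ (r - i.+1)).
    pose V : {poly int} := E i.+1 - (U i.+1 \Po P).
    have [|Q QE] := eta_dvd (A - 3%:Z *: V).
      transitivity (evK A - 3%:R * evK V).
        exact: etrans (evB _ _) (congr1 (fun y => _ - y) (evZ _ _)).
      rewrite /A /V evM evX.
      rewrite (evB (E i.+1) _) compE PE.
      rewrite -(EE i (le_i i lt_i)).
      rewrite -(EE i.+1 lt_i).
      rewrite relK.
      exact: subrr.
    by exists Q; rewrite -QE addrC subrK.
  - pose A : {poly int} := E w * P ^+ (3 ^ (r - w)).
    have [|Q QE] := eta_dvd (A - 3%:Z *: W).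
      transitivity (evK A - 3%:R * evK W).
        exact: etrans (evB _ _) (congr1 (fun y => _ - y) (evZ _ _)).
      have -> : evK W = - ((map_poly (intr : int -> K) l).[pi] +
          (b0%:~R + a0%:~R * theta ^+ m)).
        by rewrite /evK /W rmorphN hornerN -/(evK _) !evD compE PE evC evZ evX -thetaE.
      by rewrite /A evM evX PE -(EE w (leqnn w)) eps_low mulNr mulrN opprK addNr.
    by exists Q; rewrite -QE addrC subrK.
  - move=> i lt_i; rewrite rootE compL Px at0 intL0.
    by have [] := UP i lt_i.
  (* At [x], where [P] vanishes and [l] has no constant term to add, only [b0 + a0 * z ^ m] remains
     up to sign. As [z] is nonzero, exactly one of its terms is nonzero. *)
  move=> lt_wr; rewrite /W rootE /toL rmorphN hornerN oppr_eq0 rmorphD hornerD -/toL.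
  rewrite compL Px at0 l0 add0r rmorphD hornerD /= map_polyC hornerC map_polyZ.
  rewrite hornerZ rmorphXn horner_exp -/toL -/z.
  have z_neq0 : z != 0.
    apply/eqP => z0; move: hz; rewrite /h /toL rmorphB /= map_polyXn map_polyC z0.
    rewrite hornerD hornerN hornerXn hornerC expr0n /= expn_eq0 /= sub0r => /eqP.
    by rewrite oppr_eq0 intL0 (negPf sN3).
  move: xor0; rewrite lt_wr /= -!intL0.
  have [->|a0_neq0] := eqVneq (a0%:~R : L) 0; first by rewrite mul0r addr0.
  by move=> /eqP->; rewrite add0r mulf_neq0 // expf_neq0.
(* Modulo 3 the trinomial is ['X^(2 ^ k * 3 ^ r) - s ^ (3 ^ r)], a [3 ^ r]-th power by Frobenius. *)
have charT : toL (char_poly (horner_mx C T)) = toL h ^+ (3 ^ (r - w + w)).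
  rewrite subnK // charF /h /F /trinomial /toL !rmorphD rmorphN /= map_polyZ !map_polyXn.
  rewrite !map_polyC (exprB_pchar_pow _ _ _ pcharL) // -exprM /=.
  have -> : a%:~R = 0 :> L.
    by apply/eqP; rewrite (intr_eq0_pchar _ pcharL) aE exprS -mulrA dvdz_mulr.
  rewrite scale0r addr0; congr (_ + _); rewrite -polyCN -rmorphXn -rmorphN; congr (_%:P).
  apply/eqP; rewrite -subr_eq0 -rmorphB (intr_eq0_pchar _ pcharL) opprK addrC bE.
  by rewrite exprS -mulrA dvdz_mulr.
have [zs' [uniq_zs' lt_zs'] zs'P] := fixed_roots L pcharL.
have zs'_zs : {subset zs' <= zs}.
  move=> z /zs'P[zs_root _]; rewrite -root_prod_XsubC -zsE rootE.
  by rewrite hornerD hornerN hornerXn hornerC zs_root subrr.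
have := fixed_fibres_bound phiL C_shifts uniq_zs hE charT rank_ge coins f_gt0
  uniq_zs' zs'_zs (fun z zP => (zs'P z zP).2).
by rewrite leqNgt lt_zs'.
Qed.

(** * Choice of the lift, fixed roots and the congruence cases *)

(** Each cubing multiplies the deviation from [s] by 3, up to higher powers of 3. *)
Lemma exp3_pow_sign (s t : int) (w : nat) : s ^+ 2 = 1 ->
  exists y, (s + 3%:Z * t) ^+ (3 ^ w) = s + 3%:Z ^+ w.+1 * (t + 3%:Z * y).
Proof.
move=> s2; have s3 : s ^+ 3 = s by rewrite exprS s2 mulr1.
elim: w => [|w [y IHw]]; first by exists 0; rewrite mulr0 addr0 !expr1.
set u := t + _ in IHw; set N := 3%:Z ^+ w in IHw *.
(* Expand [(s + 3 * N * u) ^ 3], subtract [s + 9 * N * t] and divide by [27 * N]. *)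
exists (y + s * N * u ^+ 2 + N ^+ 2 * u ^+ 3).
rewrite expnSr exprM IHw !exprS -/N.
transitivity (s ^+ 3 + 3%:Z * (s ^+ 2 * (3%:Z * N * u)) +
    3%:Z * (s * (3%:Z * N * u) ^+ 2) + (3%:Z * N * u) ^+ 3); first by ring.
by rewrite s2 s3 /u; ring.
Qed.

(** The two roots 1 and -1 lie in the field with 3 elements, and [2 * w.+1 > 3] already. *)
Lemma fixed_roots_one (L : closedFieldType) (k w : nat) : (0 < k)%N -> (0 < w)%N ->
  3 \in [pchar L] -> exists2 zs : seq L, uniq zs /\ (3 ^ 1 < size zs * w.+1)%N &
    {in zs, forall z, z ^+ (2 ^ k) = 1%:~R /\ z ^+ (3 ^ 1) = z}.
Proof.
move=> k_gt0 w_gt0 pcharL; exists [:: 1; -1]; first split; rewrite /= ?andbT.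
- rewrite inE -subr_eq0 opprK -[1 + 1]/(2%:R) -(dvdn_pcharf pcharL) //.
- by rewrite expn1; lia.
move=> z; rewrite !inE => /orP[] /eqP->; rewrite ?expr1n //; split.
  by rewrite -signr_odd oddX eqn0Ngt k_gt0.
by rewrite -signr_odd expr1.
Qed.

(** For [k <= 2] all [2 ^ k] roots are eighth roots of unity, so they lie in the field with 9
    elements. *)
Lemma fixed_roots_opp_one (L : closedFieldType) (k w : nat) : (0 < k <= 2)%N ->
  (9 < 2 ^ k * w.+1)%N -> 3 \in [pchar L] ->
  exists2 zs : seq L, uniq zs /\ (3 ^ 2 < size zs * w.+1)%N &
    {in zs, forall z, z ^+ (2 ^ k) = (-1)%:~R /\ z ^+ (3 ^ 2) = z}.
Proof.
move=> k_bounds w_gt pcharL.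
have [|||zs uniq_zs zsE] := @uniq_roots_XnsubC L (2 ^ k) (-1).
- by rewrite expn_gt0.
- by rewrite -(dvdn_pcharf pcharL) Euclid_dvdX.
- by rewrite oppr_eq0 oner_neq0.
have size_zs : size zs = (2 ^ k)%N.
  apply/eqP; rewrite -eqSS -(size_prod_XsubC zs id) -zsE.
  by rewrite -[(2 ^ k)%N]prednK ?expn_gt0 // size_XnsubC_succ.
exists zs => [|z]; first by rewrite size_zs.
rewrite -root_prod_XsubC -zsE rootE hornerD hornerN hornerXn hornerC opprK.
rewrite addr_eq0 => /eqP z2k; split; first by rewrite z2k rmorphN1.
have z4 : z ^+ 4 ^+ 2 = 1.
  case: k k_bounds z2k {w_gt zsE size_zs} => [|[|[|k]]] // _ z2k.
    by rewrite (exprM z 2 2) z2k sqrrN !expr1n.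
  by rewrite z2k sqrrN expr1n.
by rewrite (_ : (3 ^ 2 = (4 * 2).+1)%N) // exprS exprM z4 mulr1.
Qed.

Lemma dvd3_choice (a0 b0 : int) : exists t, (3%:Z %| a0)%Z (+) (3%:Z %| b0 + t)%Z.
Proof.
have [a3|a3] := boolP (3%:Z %| a0)%Z; last by exists (- b0); rewrite subrr dvdz0.
have [b3|b3] := boolP (3%:Z %| b0)%Z; last by exists 0; rewrite addr0.
by exists 1; rewrite /= rpredDl.
Qed.

(** For [w < r] the lift [s] itself serves for the norm. For [w = r], replacing [s] by [s + 3 * t]
    changes its [3 ^ r]-th power by [3 ^ w.+1 * t] modulo [3 ^ w.+2], so a suitable [t] gives the
    norm the required valuation. *)
Lemma trinomial_not_monogenic_sign (k r w m : nat) (s a b a0 b0 : int)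
    (K : fieldExtType rat) (theta : K) :
  (1 <= m < 2 ^ k * 3 ^ r)%N ->
  irreducible_over_Q (trinomial (2 ^ k * 3 ^ r) m a b) ->
  root (map_poly (intr : int -> K) (trinomial (2 ^ k * 3 ^ r) m a b)) theta ->
  <<1; theta>>%VS = {:K}%VS ->
  (0 < w <= r)%N ->
  s = 1 /\ (0 < k)%N \/ s = -1 /\ (0 < k <= 2)%N /\ (9 < 2 ^ k * w.+1)%N ->
  a = 3%:Z ^+ w.+1 * a0 -> s + b = 3%:Z ^+ w.+1 * b0 ->
  (w < r)%N ==> ((3%:Z %| a0)%Z (+) (3%:Z %| b0)%Z) ->
  ~ monogenic K.
Proof.
move=> m_bounds F_irr Ftheta K_gen w_bounds s_sign aE bE xor0.
have s2 : s ^+ 2 = 1 by case: s_sign => [[->]|[->]].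
have sN3 : ~~ (3%:Z %| s)%Z by case: s_sign => [[->]|[->]].
have spow : s ^+ (3 ^ r) = s.
  by case: s_sign => [[-> _]|[-> _]]; rewrite ?expr1n // -signr_odd oddX orbT.
have [f f_gt0 fixed] : exists2 f, (0 < f)%N & forall L : closedFieldType,
     3 \in [pchar L] -> exists2 zs : seq L, uniq zs /\ (3 ^ f < size zs * w.+1)%N &
     {in zs, forall z, z ^+ (2 ^ k) = s%:~R /\ z ^+ (3 ^ f) = z}.
  case: s_sign => [[-> k_gt0]|[-> [k_bounds w_gt]]].
    exists 1%N => // L; apply: fixed_roots_one => //; by case/andP: w_bounds.
  by exists 2%N => // L; apply: fixed_roots_opp_one.
have bE' : s ^+ (3 ^ r) + b = 3%:Z ^+ w.+1 * b0 by rewrite spow.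
have [lt_wr|le_rw] := ltnP w r.
  apply: (@trinomial_not_monogenic k r w f m s a b a0 b0 0 b0 K theta) => //.
    by rewrite mulr0 addr0.
  by rewrite lt_wr in xor0.
have rw : r = w by apply/eqP; rewrite eqn_leq le_rw andbC; case/andP: w_bounds => _ ->.
have [t xor1] := dvd3_choice a0 b0; have [y yE] := exp3_pow_sign t r s2.
apply: (@trinomial_not_monogenic k r w f m s a b a0 b0 t (b0 + t + 3%:Z * y) K theta) => //.
  by rewrite yE rw addrAC bE; ring.
by rewrite rpredDr // dvdz_mulr.
Qed.

Lemma mod_multiple (N s b c : int) : (b = N * c - s %[mod N * 3%:Z])%Z ->
  exists2 b0, s + b = N * b0 & (3%:Z %| b0)%Z = (3%:Z %| c)%Z.
Proof.
move/eqP; rewrite eqz_mod_dvd => /dvdzP[q qE]; exists (c + 3%:Z * q).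
  by rewrite mulrDr mulrA [N * 3%:Z * q]mulrC -qE; ring.
by rewrite rpredDr // dvdz_mulr.
Qed.

Theorem corollary2p4 (k r m : nat) (a b : int)
    (K : fieldExtType rat) (theta : K)
    (k_ge1 : (1 <= k)%N) (r_ge1 : (1 <= r)%N)
    (m_bounds : (1 <= m < 2 ^ k * 3 ^ r)%N)
    (F_irr : irreducible_over_Q (trinomial (2 ^ k * 3 ^ r) m a b))
    (theta_root :
       root (map_poly (intr : int -> K) (trinomial (2 ^ k * 3 ^ r) m a b)) theta)
    (K_gen : <<1; theta>>%VS = {:K}%VS)
    (hyp :
      (* (1) *)
      ((1 <= k)%N /\ (2 <= r)%N /\
         ((a = 9 %[mod 27])%Z \/ (a = 18 %[mod 27])%Z) /\
         (b = -1 %[mod 27])%Z) \/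
      (* (2) *)
      ((1 <= k)%N /\ (3 <= r)%N /\
         ((a = 27 %[mod 81])%Z \/ (a = 54 %[mod 81])%Z) /\
         (b = -1 %[mod 81])%Z) \/
      (* (3) *)
      ((1 <= k)%N /\ (2 <= r)%N /\
         (a = 0 %[mod 27])%Z /\
         ((b = 8 %[mod 27])%Z \/ (b = 17 %[mod 27])%Z)) \/
      (* (4) *)
      ((1 <= k)%N /\ (3 <= r)%N /\
         (a = 0 %[mod 81])%Z /\
         ((b = 26 %[mod 81])%Z \/ (b = 53 %[mod 81])%Z)) \/
      (* (5) *)
      ((1 <= k)%N /\ r = 1%N /\
         (a = 0 %[mod 9])%Z /\ (b = -1 %[mod 9])%Z) \/
      (* (6) *)
      ((1 <= k)%N /\ r = 2%N /\
         (a = 0 %[mod 27])%Z /\ (b = -1 %[mod 27])%Z) \/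
      (* (7) *)
      (k = 1%N /\ (7 <= r)%N /\
         ((a = 3 ^+ 7 %[mod 3 ^+ 8])%Z \/ (a = 2 * 3 ^+ 7 %[mod 3 ^+ 8])%Z) /\
         (b = 1 %[mod 3 ^+ 8])%Z) \/
      (* (8) *)
      (k = 1%N /\ (7 <= r)%N /\
         (a = 0 %[mod 3 ^+ 8])%Z /\
         ((b = 1 + 3 ^+ 7 %[mod 3 ^+ 8])%Z \/
          (b = 1 + 2 * 3 ^+ 7 %[mod 3 ^+ 8])%Z)) \/
      (* (9) *)
      (k = 1%N /\ r = 6%N /\
         (a = 0 %[mod 3 ^+ 7])%Z /\ (b = 1 %[mod 3 ^+ 7])%Z) \/
      (* (10) *)
      (k = 2%N /\ (4 <= r)%N /\
         ((a = 81 %[mod 243])%Z \/ (a = 162 %[mod 243])%Z) /\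
         (b = 1 %[mod 243])%Z) \/
      (* (11) *)
      (k = 2%N /\ (4 <= r)%N /\
         (a = 0 %[mod 243])%Z /\
         ((b = 82 %[mod 3 ^+ 5])%Z \/ (b = 163 %[mod 3 ^+ 5])%Z)) \/
      (* (12) *)
      (k = 2%N /\ r = 3%N /\
         (a = 0 %[mod 81])%Z /\ (b = 1 %[mod 81])%Z)) :
  ~ monogenic K.

Proof.
(* Cases with [w < r]: the congruences modulo [3 ^ w.+2] fix the two quotients by [3 ^ w.+1] modulo
   3, and exactly one of these is divisible by 3. *)
have caseA w (s ca cb : int) : (0 < w < r)%N ->
    s = 1 /\ (0 < k)%N \/ s = -1 /\ (0 < k <= 2)%N /\ (9 < 2 ^ k * w.+1)%N ->
    (a = 3 ^+ w.+1 * ca %[mod 3 ^+ w.+2])%Z ->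
    (b = 3 ^+ w.+1 * cb - s %[mod 3 ^+ w.+2])%Z ->
    (3%:Z %| ca)%Z (+) (3%:Z %| cb)%Z -> ~ monogenic K.
  rewrite [3 ^+ w.+2]exprSr => /andP[w_gt0 lt_wr] s_sign aE bE xor.
  have {}aE : (a = 3 ^+ w.+1 * ca - 0 %[mod 3 ^+ w.+1 * 3%:Z])%Z by rewrite subr0.
  have [a0 a0E a03] := mod_multiple aE.
  have [b0 b0E b03] := mod_multiple bE; rewrite add0r in a0E.
  apply: (trinomial_not_monogenic_sign m_bounds F_irr theta_root K_gen _ s_sign a0E b0E).
    by rewrite w_gt0 ltnW.
  by rewrite a03 b03 xor implybT.
(* Cases with [r = w]: the congruences modulo [3 ^ w.+1] leave the quotients arbitrary, and the
   choice of the lift takes over. *)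
have caseB w (s : int) : r = w -> (0 < w)%N ->
    s = 1 /\ (0 < k)%N \/ s = -1 /\ (0 < k <= 2)%N /\ (9 < 2 ^ k * w.+1)%N ->
    (a = 0 %[mod 3 ^+ w.+1])%Z -> (b = - s %[mod 3 ^+ w.+1])%Z -> ~ monogenic K.
  move=> rw w_gt0 s_sign /eqP; rewrite eqz_mod_dvd subr0 => /dvdzP[a0 a0E].
  move/eqP; rewrite eqz_mod_dvd opprK addrC => /dvdzP[b0 b0E].
  rewrite mulrC in a0E; rewrite mulrC in b0E.
  apply: (trinomial_not_monogenic_sign m_bounds F_irr theta_root K_gen _ s_sign a0E b0E).
    by rewrite w_gt0 rw leqnn.
  by rewrite rw ltnn.
have pos w : 1 = 1 :> int /\ (0 < k)%N \/
    1 = -1 :> int /\ (0 < k <= 2)%N /\ (9 < 2 ^ k * w.+1)%N by left.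
have neg w : (0 < k <= 2)%N -> (9 < 2 ^ k * w.+1)%N ->
    -1 = 1 :> int /\ (0 < k)%N \/
    -1 = -1 :> int /\ (0 < k <= 2)%N /\ (9 < 2 ^ k * w.+1)%N by right.
case: hyp => [[_ [r2 [[aE|aE] bE]]]|].
- exact: (caseA 1%N 1 1 0 r2 (pos _) aE bE).
- exact: (caseA 1%N 1 2 0 r2 (pos _) aE bE).
case=> [[_ [r3 [[aE|aE] bE]]]|].
- exact: (caseA 2%N 1 1 0 r3 (pos _) aE bE).
- exact: (caseA 2%N 1 2 0 r3 (pos _) aE bE).
case=> [[_ [r2 [aE [bE|bE]]]]|].
- exact: (caseA 1%N 1 0 1 r2 (pos _) aE bE).
- exact: (caseA 1%N 1 0 2 r2 (pos _) aE bE).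
case=> [[_ [r3 [aE [bE|bE]]]]|].
- exact: (caseA 2%N 1 0 1 r3 (pos _) aE bE).
- exact: (caseA 2%N 1 0 2 r3 (pos _) aE bE).
case=> [[_ [r1 [aE bE]]]|]; first exact: (caseB 1%N 1 r1 isT (pos _) aE bE).
case=> [[_ [r2 [aE bE]]]|]; first exact: (caseB 2%N 1 r2 isT (pos _) aE bE).
case=> [[k1 [r7 [aE bE]]]|].
  have {}bE : (b = 3 ^+ 7 * 0 - (-1) %[mod 3 ^+ 8])%Z by rewrite mulr0 sub0r opprK.
  case: aE => aE.
    by apply: (caseA 6%N (-1) 1 0 r7 (neg _ _ _) _ bE); rewrite ?k1 ?mulr1.
  by apply: (caseA 6%N (-1) 2 0 r7 (neg _ _ _) _ bE); rewrite ?k1 // mulrC.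
case=> [[k1 [r7 [aE bE]]]|].
  have {}aE : (a = 3 ^+ 7 * 0 %[mod 3 ^+ 8])%Z by rewrite mulr0.
  case: bE => bE.
    by apply: (caseA 6%N (-1) 0 1 r7 (neg _ _ _) aE); rewrite ?k1 // mulr1 opprK addrC.
  by apply: (caseA 6%N (-1) 0 2 r7 (neg _ _ _) aE); rewrite ?k1 // mulrC opprK addrC.
case=> [[k1 [r6 [aE bE]]]|].
  by apply: (caseB 6%N (-1) r6 isT (neg _ _ _) aE); rewrite ?k1 ?opprK.
case=> [[k2 [r4 [aE bE]]]|].
  case: aE => aE; [apply: (caseA 3%N (-1) 1 0 r4 (neg _ _ _) aE bE)|
                   apply: (caseA 3%N (-1) 2 0 r4 (neg _ _ _) aE bE)]; by rewrite ?k2.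
case=> [[k2 [r4 [aE bE]]]|[k2 [r3 [aE bE]]]].
  case: bE => bE; [apply: (caseA 3%N (-1) 0 1 r4 (neg _ _ _) aE bE)|
                   apply: (caseA 3%N (-1) 0 2 r4 (neg _ _ _) aE bE)]; by rewrite ?k2.
by apply: (caseB 3%N (-1) r3 isT (neg _ _ _) aE bE); rewrite ?k2.
Qed.
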